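(* For every $\varepsilon>0$ there exists $r\in\mathbb{N}$ such that, for every bounded linear operator $T\in\mathcal{B}(\ell^2)$ with $\mathrm{diag}(T)=0$, there exists a family $Q_1,\dots,Q_r$ of diagonal projectors on $\ell^2$ such that $\sum_{i=1}^r Q_i=1$ and $\|Q_iTQ_i\|\le \varepsilon\|T\|$ for all $i=1,\dots,r$.
   Context: $\ell^2=\ell^2(\mathbb{N})$ is the complex Hilbert space of square-summable sequences, with canonical orthonormal basis $(\mathbf{e}_k)_k$ and inner product $\langle \mathbf{x}|\mathbf{y}\rangle=\sum_n x_n\overline{y_n}$. $\mathcal{B}(\ell^2)$ is the algebra of bounded linear operators on $\ell^2$, with operator norm $\|T\|=\sup_{\|\mathbf{x}\|_2\le 1}\|T(\mathbf{x})\|_2$. For $T\in\mathcal{B}(\ell^2)$, $\mathrm{diag}(T)$ is the sequence of diagonal values $(\langle T\mathbf{e}_k|\mathbf{e}_k\rangle)_k$. A projector is an operator $P$ with $P=P^*=P^2$; it is diagonal if its matrix in the canonical basis is diagonal (equivalently, it is the orthogonal projection onto the closed span of $\{\mathbf{e}_k : k\in A\}$ for some, possibly empty, $A\subset\mathbb{N}$). $1$ denotes the identity operator. *)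

(* Defs.v *)
From HB Require Import structures.
From mathcomp Require Import all_boot all_order all_algebra.
From mathcomp Require Import complex ring.
From mathcomp Require Import all_classical all_reals all_analysis.

Set Implicit Arguments.
Unset Strict Implicit.
Unset Printing Implicit Defensive.
Import Order.TTheory GRing.Theory Num.Theory.
Import numFieldNormedType.Exports.

Local Open Scope classical_set_scope.
Local Open Scope ring_scope.
Local Open Scope complex_scope.

Section Ell2.
Variable R : realType.

(* [Normc.normc z : R] is the modulus of [z : R[i]]; the notation [`|z|] would
   denote the same number as an element of [R[i]]. *)
Definition sqmod (x : nat -> R[i]) : R^nat := fun n => Normc.normc (x n) ^+ 2.

Definition square_summable : {pred nat -> R[i]} :=
  [pred x : nat -> R[i] | `[< cvgn (series (sqmod x)) >]].

Lemma square_summableP (x : nat -> R[i]) :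
  reflect (cvgn (series (sqmod x))) (x \in square_summable).
Proof. exact: asboolP. Qed.

Lemma square_summable_submod_closed : submod_closed square_summable.
Proof.
split=> [|a x y /square_summableP cx /square_summableP cy].
  apply/square_summableP; rewrite (_ : series _ = cst 0); first exact: is_cvg_cst.
  apply/funext => n; rewrite /series /= big1// => i _.
  by rewrite /sqmod [Normc.normc _]Normc.normc0 expr0n.
apply/square_summableP.
have normc_ge0 (z : R[i]) : 0 <= Normc.normc z by case: z => ? ?; exact: sqrtr_ge0.
pose b : R^nat := 2 * Normc.normc a ^+ 2 *: (sqmod x : nat -> R^o)
  + 2 *: (sqmod y : nat -> R^o).
have bE n : b n = 2 * Normc.normc a ^+ 2 * sqmod x n + 2 * sqmod y n by [].
apply: (@series_le_cvg _ _ b) => [n|n|n|].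
- by rewrite /sqmod sqr_ge0.
- by rewrite bE addr_ge0// !mulr_ge0// sqr_ge0.
- rewrite bE /sqmod -mulrA -exprMn -Normc.normcM.
  rewrite (_ : (a *: x + y) n = a * x n + y n)//.
  set u := a * x n; set v := y n.
  apply: (@le_trans _ _ ((Normc.normc u + Normc.normc v) ^+ 2)).
    by rewrite lerXn2r ?nnegrE ?addr_ge0// le_normcD.
  rewrite -subr_ge0 (_ : _ - _ = (Normc.normc u - Normc.normc v) ^+ 2) ?sqr_ge0//.
  ring.
- by rewrite seriesD; apply: is_cvgD; exact: is_cvg_seriesZ.
Qed.

HB.instance Definition _ := GRing.isSubmodClosed.Build R[i] (nat -> R[i])
  square_summable square_summable_submod_closed.

Record ell2 := Ell2 {
  ell2_seq :> nat -> R[i];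
  ell2_summable : ell2_seq \in square_summable }.

HB.instance Definition _ := [isSub for ell2_seq].
HB.instance Definition _ := [Choice of ell2 by <:].
HB.instance Definition _ := [SubChoice_isSubLmodule of ell2 by <:].

(* The series converges absolutely; [R[i]^o] carries the topology of the norm
   of [R[i]]. *)
Definition inner (x y : ell2) : R[i] :=
  limn (series (fun n => x n * (y n)^* : R[i]^o)).

Definition l2norm (x : ell2) : R := Num.sqrt (limn (series (sqmod x))).

Lemma ebasis_summable (k : nat) :
  (fun n => (n == k)%:R : R[i]) \in square_summable.
Proof.
apply/square_summableP; apply/cvg_ex; exists 1; apply: cvg_near_cst.
near=> n; rewrite /series /=.
have kn : (k < n)%N by near: n; exact: nbhs_infty_gt.
rewrite big_mkord (bigD1 (Ordinal kn))//= big1 ?addr0.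
  by rewrite /sqmod eqxx [Normc.normc _]Normc.normc1 expr1n.
move=> i /negPf; rewrite -val_eqE /= => ik.
by rewrite /sqmod ik [Normc.normc _]Normc.normc0 expr0n.
Unshelve. all: by end_near. Qed.

Definition ebasis (k : nat) : ell2 := Ell2 (ebasis_summable k).

Record bounded_op := BoundedOp {
  bounded_op_fun :> {linear ell2 -> ell2};
  bounded_opP :
    exists M : R, forall x : ell2, l2norm (bounded_op_fun x) <= M * l2norm x }.

(* The supremum is taken over a nonempty set, bounded above by [bounded_opP]. *)
Definition opnorm (T : bounded_op) : R :=
  sup [set l2norm (T x) | x in [set x : ell2 | l2norm x <= 1]].

Lemma comp_op_bounded (S T : bounded_op) :
  exists M : R, forall x : ell2, l2norm ((S \o T) x) <= M * l2norm x.
Proof.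
case: (bounded_opP S) (bounded_opP T) => [M HM] [N HN].
exists (Num.max 0 M * N) => x /=.
rewrite (le_trans (HM _))//.
apply: (@le_trans _ _ (Num.max 0 M * l2norm (T x))).
  by rewrite ler_wpM2r ?sqrtr_ge0// le_max lexx orbT.
by rewrite -mulrA ler_wpM2l ?le_max ?lexx.
Qed.

Definition comp_op (S T : bounded_op) : bounded_op :=
  BoundedOp (comp_op_bounded S T).

Definition op_diag (T : bounded_op) : nat -> R[i] :=
  fun k => inner (T (ebasis k)) (ebasis k).

(* [S] is the adjoint of [T]. *)
Definition is_adjoint (T S : bounded_op) : Prop :=
  forall x y : ell2, inner (T x) y = inner x (S y).

(* [P = P^* = P^2]; operators are compared pointwise, as [bounded_op] is a
   record. *)
Definition projector (P : bounded_op) : Prop :=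
  is_adjoint P P /\ comp_op P P =1 P.

Definition diagonal_op (T : bounded_op) : Prop :=
  forall j k : nat, j != k -> inner (T (ebasis k)) (ebasis j) = 0.

End Ell2.

(* Main.v *)
Require Import Defs.
From HB Require Import structures.
From mathcomp Require Import all_boot all_order all_algebra.
From mathcomp Require Import complex polyrcf ring lra zify.
From mathcomp Require boolp.
Set Implicit Arguments.
Unset Strict Implicit.
Unset Printing Implicit Defensive.
Import Order.TTheory GRing.Theory Num.Theory.
Local Open Scope ring_scope.
Local Open Scope complex_scope.

(**
The method of interlacing polynomials of Marcus, Spielman and Srivastava, applied
directly to a hermitian contraction [A] with zero diagonal, in the manner of
Leake, Ravichandran and Srivastava. The product over the colour classes of the
characteristic polynomials of the compressions of [A], summed over all the
colourings of the [n] coordinates with [r] colours, is up to a factor the result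
of deriving [r - 1] times in each variable [z_i] the polynomial
[det (diag (z_1, .., z_n) - A) ^ r]. This polynomial is real stable. A barrier
argument shows that its derivative has no zero above [6 a / (a ^ 2 - 1)], where
[a ^ 2 = 2 r + 5]: the barrier starts at [z = (a, .., a)], and the zero diagonal
makes the zeros in each variable nonnegative with small mean, so that each
derivative allows a definite decrease of its variable. A common interlacing
argument then selects the colour of each coordinate in turn. This bounds the
compressions of [A] from above by a constant that tends to [0] as [r] grows.
Refining the colourings obtained for the hermitian and antihermitian parts and
for their opposites treats an arbitrary matrix, and a compactness argument on
colourings of [nat] passes from the finite sections to the operator.
*)

(** * Rational functions preserving a half plane *)

(** The polynomial is handled in polarised form: each colour [c] has its own copy [(i, c)] of the
    variable of coordinate [i]. The product is then affine in every variable, its partial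
    derivatives are products of principal minors, and a set [Q] of copies records those already
    derived. After [r - 1] derivations in direction [i] exactly one copy of [i] is left, and this
    copy is the colour of [i].

    With [mu = a / (a ^ 2 - 1)], the zero diagonal bounds the diagonal entries of [1 / (a - A)] by
    [mu]. A direction with degree [m] left sits at height [mu * (2 * m + 4)]. It starts with
    [m = r], and [a = mu * (2 * r + 4)] means [a ^ 2 = 2 * r + 5]; it stops with [m = 1], at
    [6 * mu]. Within a direction, the quantity carried along is the mean of the zeros, which
    derivation preserves; from one direction to the next it is the logarithmic derivative, from
    which the mean is recovered. *)

Lemma not_uniq_perm_cons (T : eqType) (s : seq T) : ~~ uniq s ->
  exists r s', perm_eq s (r :: s') /\ r \in s'.
Proof.
elim: s => //= x s IHs; rewrite negb_and negbK => /orP[xs|/IHs[r [s' [ss' rs']]]].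
  by exists x, s.
exists r, (x :: s'); split; last by rewrite inE rs' orbT.
by rewrite -(perm_cons x) in ss'; rewrite (perm_trans ss')// (perm_catCA [:: x] [:: r] s').
Qed.

Section Univariate.
Variable R : rcfType.
Local Notation C := R[i].
Local Notation Re := (@complex.Re R).
Local Notation Im := (@complex.Im R).
Local Notation conj := (@conjc R).
Local Notation toC := (map_poly (real_complex R)).
Implicit Types (p q u g w : {poly R}) (rs : seq R) (x y t : R).

(** Passages to the limit and intermediate values in a real parameter reduce, through this form, to
    real polynomials. *)
Definition polyfun (f : R -> C) :=
  exists a b : {poly R}, forall x, f x = a.[x] +i* b.[x].

Lemma eq_polyfun f h : f =1 h -> polyfun f -> polyfun h.
Proof. by move=> fh [a [b ab]]; exists a, b => x; rewrite -fh. Qed.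

Lemma polyfun_cst c : polyfun (fun=> c).
Proof. by case: c => a b; exists a%:P, b%:P => x; rewrite !hornerC. Qed.

Lemma polyfun_id : polyfun (fun x => x%:C).
Proof. by exists 'X, 0 => x; rewrite hornerX horner0. Qed.

Lemma polyfunD f h : polyfun f -> polyfun h -> polyfun (fun x => f x + h x).
Proof.
move=> [a [b fE]] [a' [b' hE]]; exists (a + a'), (b + b') => x.
by rewrite fE hE !hornerD.
Qed.

Lemma polyfunM f h : polyfun f -> polyfun h -> polyfun (fun x => f x * h x).
Proof.
move=> [a [b fE]] [a' [b' hE]]; exists (a * a' - b * b'), (a * b' + b * a') => x.
by rewrite fE hE !hornerE.
Qed.

Lemma polyfunN f : polyfun f -> polyfun (fun x => - f x).
Proof. by move=> [a [b fE]]; exists (- a), (- b) => x; rewrite fE !hornerN. Qed.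

Lemma polyfun_conj f : polyfun f -> polyfun (fun x => conj (f x)).
Proof. by move=> [a [b fE]]; exists a, (- b) => x; rewrite fE !hornerN. Qed.

Lemma polyfun_sum (I : Type) (r : seq I) (P : pred I) (F : I -> R -> C) :
  (forall i, P i -> polyfun (F i)) ->
  polyfun (fun x => \sum_(i <- r | P i) F i x).
Proof.
move=> FP; elim: r => [|i r IHr].
  by apply: (eq_polyfun _ (polyfun_cst 0)) => x; rewrite big_nil.
case Pi: (P i); last by apply: (eq_polyfun _ IHr) => x; rewrite big_cons Pi.
by apply: (eq_polyfun _ (polyfunD (FP i Pi) IHr)) => x; rewrite big_cons Pi.
Qed.

Lemma polyfun_prod (I : Type) (r : seq I) (P : pred I) (F : I -> R -> C) :
  (forall i, P i -> polyfun (F i)) ->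
  polyfun (fun x => \prod_(i <- r | P i) F i x).
Proof.
move=> FP; elim: r => [|i r IHr].
  by apply: (eq_polyfun _ (polyfun_cst 1)) => x; rewrite big_nil.
case Pi: (P i); last by apply: (eq_polyfun _ IHr) => x; rewrite big_cons Pi.
by apply: (eq_polyfun _ (polyfunM (FP i Pi) IHr)) => x; rewrite big_cons Pi.
Qed.

Lemma polyfun_horner (p : {poly C}) f : polyfun f -> polyfun (fun x => p.[f x]).
Proof.
move=> fP; elim/poly_ind: p => [|p c IHp].
  by apply: (eq_polyfun _ (polyfun_cst 0)) => x; rewrite horner0.
apply: (eq_polyfun _ (polyfunD (polyfunM IHp fP) (polyfun_cst c))) => x.
by rewrite hornerD hornerM hornerX hornerC.
Qed.

Lemma polyfun_det n (M : R -> 'M[C]_n) :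
  (forall i j, polyfun (fun x => M x i j)) -> polyfun (fun x => \det (M x)).
Proof.
move=> MP; apply: polyfun_sum => s _; apply: polyfunM.
  exact: polyfun_cst.
by apply: polyfun_prod => i _.
Qed.

Lemma Im_realM x (z : C) : Im (x%:C * z) = x * Im z.
Proof. by case: z => a b /=; rewrite mul0r addr0. Qed.

Lemma poly_ge0_at0 p : (forall x, 0 < x -> 0 <= p.[x]) -> 0 <= p.[0].
Proof.
move=> p_ge0; rewrite leNgt; apply/negP => p0_lt0.
have e_gt0 : 0 < - p.[0] by rewrite oppr_gt0.
have [d d_gt0 /(_ (d / 2))] := poly_cont 0 p e_gt0.
have d2 : 0 < d / 2 by rewrite divr_gt0.
rewrite subr0 gtr0_norm// => /(_ _)/wrap[]; first lra.
by move=> /(le_lt_trans (ler_norm _)); have := p_ge0 _ d2; lra.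
Qed.

Lemma polyfun_Im_ge0 f : polyfun f -> (forall x, 0 < x -> 0 <= Im (f x)) ->
  0 <= Im (f 0).
Proof.
move=> [a [b fE]] f_ge0; rewrite fE /=; apply: poly_ge0_at0 => x x_gt0.
by have := f_ge0 x x_gt0; rewrite fE.
Qed.

Lemma horner_toC p x : (toC p).[x%:C] = p.[x]%:C.
Proof. exact: horner_map. Qed.

(** Nonreal roots of a real polynomial come in conjugate pairs, so excluding the open upper half
    plane excludes them all. *)
Lemma real_rooted_factor p :
  (forall t : C, 0 < Im t -> (toC p).[t] != 0) ->
  exists rs, p = lead_coef p *: \prod_(r <- rs) ('X - r%:P).
Proof.
move=> pUH; have [r pE] := closed_field_poly_normal (toC p).
have rIm z : z \in r -> z = (Re z)%:C.
  move=> zr; have rz : root (toC p) z.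
    by apply/rootP; rewrite pE hornerZ (rootP _) ?mulr0// root_prod_XsubC.
  have [Imz|Imz|Imz] := ltgtP (Im z) 0; last by case: z Imz {zr rz} => a b /= ->.
  - have /pUH/negP[] : 0 < Im (conj z) by case: z Imz {zr rz} => a b /=; lra.
    rewrite -rootE -complex_root_conj -map_poly_comp.
    rewrite (eq_map_poly (g := real_complex R))// => x /=.
    exact: conjc_real.
  - by have /negP[] := pUH _ Imz; rewrite -rootE.
exists (map Re r).
apply: (@map_poly_inj _ _ (real_complex R)) => /=.
rewrite [LHS]pE map_polyZ /= lead_coef_map /=.
congr (_ *: _); rewrite rmorph_prod big_map /= big_seq [RHS]big_seq.
by apply: eq_bigr => z zr; rewrite rmorphB /= map_polyX map_polyC /= -rIm.
Qed.

(* [g / u] maps the upper half plane to the closed lower one. *)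
Definition nevanlinna u g := forall t : C, 0 < Im t ->
  Im ((toC g).[t] * conj (toC u).[t]) <= 0.

(* The roots of ['X^k - c] sum to [0], so that they do not all lie in the lower
   half plane. *)
Lemma exists_upper_root_neq0 (k : nat) (c : C) : (1 < k)%N -> c != 0 ->
  Re c = 0 -> exists2 z : C, z ^+ k = c & 0 < Im z.
Proof.
move=> k_gt1 c_neq0 Rec; pose p : {poly C} := 'X^k - c%:P.
have p_monic : p \is monic by rewrite monicXnsubC// ltnW.
have [r] := closed_field_poly_normal p; rewrite (monicP p_monic) scale1r => pE.
have rP z : z \in r -> z ^+ k = c.
  rewrite -root_prod_XsubC -pE => /rootP; rewrite !hornerE => /eqP.
  by rewrite subr_eq0 => /eqP.
have sz : size r = k.
  by apply: succn_inj; rewrite -(size_prod_XsubC r id) -pE size_XnsubC// ltnW.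
have [[z zr Imz]|rIm] : (exists2 z, z \in r & 0 < Im z) \/
    (forall z, z \in r -> Im z <= 0).
  have [/hasP[z zr Imz]|/hasPn rN] := boolP (has (fun z => 0 < Im z) r).
    by left; exists z.
  by right=> z /rN; rewrite leNgt.
  by exists z => //; exact: rP.
have sum0 : \sum_(z <- r) z = 0.
  have := coefPn_prod_XsubC (_ : size r != 0)%N.
  rewrite sz -lt0n (ltnW k_gt1) => /(_ isT).
  rewrite -pE coefB coefXn coefC.
  have -> : (k.-1 == k) = false 
    by apply/negbTE; case: k k_gt1 {p p_monic pE rP sz} => // k _; rewrite ltn_eqF.
  have -> : (k.-1 == 0)%N = false by case: k k_gt1 {p p_monic pE rP sz} => [|[]].
  by rewrite subrr => /esym/eqP; rewrite oppr_eq0 => /eqP.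
have : \sum_(z <- r) - Im z = 0.
  have /(congr1 (fun z => - Im z)) := sum0; rewrite oppr0.
  rewrite (_ : - Im (\sum_(z <- r) z) = \sum_(z <- r) - Im z)// sumrN.
  by congr (- _); elim/big_rec2 : _ => // z _ a _ <-; case: z a => ? ? [].
move/eqP; rewrite big_seq psumr_eq0; last by move=> z /rIm; lra.
case: r rP sz {pE rIm sum0} => [_ /esym|z r rP _ /= /andP[]].
  by move=> k0; rewrite k0 in k_gt1.
rewrite mem_head /= oppr_eq0 => /eqP Imz _.
have := rP _ (mem_head _ _); have -> : z = (Re z)%:C by case: z Imz {rP} => a b /= ->.
rewrite -rmorphXn => /= zk; move: c_neq0; rewrite -zk in Rec *.
by move: Rec => /= ->; rewrite eqxx.
Qed.

(* Near a zero [rho] of order [k] of [u], [g / u] behaves like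
 [g.[rho] / (v.[rho] * t ^+ k)]. *)
Lemma nevanlinna_local v g rho k z : nevanlinna (v * ('X - rho%:P) ^+ k) g ->
0 < Im z -> 0 <= g.[rho] * v.[rho] * Im (z ^+ k).
Proof.
move=> ug Imz; pose c := g.[rho] * v.[rho].
pose f (x : R) := - ((toC g).[rho%:C + x%:C * z] *
  conj (toC v).[rho%:C + x%:C * z] * conj (z ^+ k)).
have fP : polyfun f.
  have lP : polyfun (fun x => rho%:C + x%:C * z).
    apply: polyfunD; first exact: polyfun_cst.
    by apply: polyfunM; [exact: polyfun_id|exact: polyfun_cst].
  apply: polyfunN; apply: polyfunM; last exact: polyfun_cst.
  apply: polyfunM; first exact: polyfun_horner.
  by apply: polyfun_conj; exact: polyfun_horner.
have f0 : f 0 = - (c%:C * conj (z ^+ k)).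
  rewrite /f rmorph0 mul0r addr0 !horner_toC /c.
  by case: (z ^+ k) => a b; apply/eqP; rewrite eq_complex /=; apply/andP; split; apply/eqP; ring.
have := polyfun_Im_ge0 fP; rewrite f0.
case: (z ^+ k) f0 => a b _ /=; rewrite !mul0r addr0 mulrN opprK; apply => x x_gt0.
have xk_gt0 : 0 < x ^+ k by rewrite exprn_gt0.
have := ug (rho%:C + x%:C * z); rewrite rmorphM rmorphXn rmorphB /= map_polyX map_polyC /=.
have -> : Im (rho%:C + x%:C * z) = x * Im z by case: (z) => ? ? /=; ring.
rewrite mulr_gt0// => /(_ isT).
rewrite hornerM horner_exp hornerXsubC.
have -> : rho%:C + x%:C * z - rho%:C = x%:C * z by rewrite addrC addKr.
rewrite exprMn !rmorphM /=.
have -> : conj (x%:C ^+ k) = (x ^+ k)%:C by rewrite -rmorphXn; apply: conjc_real.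
rewrite /f; set G := _.[_]; set V := conj _; set Z := conj _.
have -> : G * (V * ((x ^+ k)%:C * Z)) = (x ^+ k)%:C * (G * V * Z) by ring.
rewrite Im_realM pmulr_rle0// -oppr_ge0.
by case: (G * V * Z).
Qed.

(** At a zero of order [k > 1], if [c = g.[rho] * v.[rho]] were nonzero, some [z] in the upper half
    plane would satisfy [z ^+ k = - c * 'i], and the local estimate would give [- c ^+ 2 >= 0]. *)
Lemma nevanlinna_multiple_root u g rho : u != 0 -> nevanlinna u g ->
  ('X - rho%:P) ^+ 2 %| u -> root g rho.
Proof.
move=> u_neq0 ug dvd; have [k [v vrho uE]] := multiplicity_XsubC u rho.
rewrite u_neq0 /= in vrho.
have k_gt1 : (1 < k)%N.
  rewrite ltnNge; apply/negP => k_le1.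
  move: dvd; rewrite uE.
  case: k k_le1 {uE} => [|[|//]] _; rewrite ?expr0 ?mulr1 ?expr1.
    move=> /(dvdp_trans (dvdp_exp2l _ (isT : 1 <= 2)%N)).
    by rewrite expr1 dvdp_XsubCl (negbTE vrho).
  by rewrite expr2 dvdp_mul2r ?polyXsubC_eq0// dvdp_XsubCl (negbTE vrho).
apply/negPn/negP => grho.
pose c := g.[rho] * v.[rho].
have c_neq0 : c != 0 by rewrite mulf_neq0.
have [|//|z zk] := @exists_upper_root_neq0 k (0 +i* (- c)) k_gt1.
  by rewrite eq_complex /= eqxx /= oppr_eq0.
rewrite uE in ug => /(nevanlinna_local ug); rewrite -/c.
rewrite zk /= mulrN oppr_ge0 -expr2 => c2_le0.
have /eqP : c ^+ 2 = 0 by apply: le_anti; rewrite c2_le0 sqr_ge0.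
by rewrite sqrf_eq0 (negbTE c_neq0).
Qed.

Lemma nevanlinna_factor rho u g :
  nevanlinna (('X - rho%:P) * u) (('X - rho%:P) * g) -> nevanlinna u g.
Proof.
move=> ug t Imt; have := ug t Imt.
rewrite !rmorphM /= map_polyXsubC !hornerM !hornerXsubC rmorphM /=.
have -> : forall a b c : C, a * b * (conj a * c) = a * conj a * (b * c) by move=> *; ring.
have -> : forall a, (a - rho%:C) * conj (a - rho%:C) = ((Re a - rho) ^+ 2 + Im a ^+ 2)%:C.
  by case=> a b; apply/eqP; rewrite eq_complex /=; apply/andP; split; apply/eqP; ring.
by rewrite Im_realM pmulr_rle0// ltr_wpDl ?sqr_ge0// exprn_gt0.
Qed.

Lemma horner_prod_XsubC_deriv rs x : all (fun r => r != x) rs ->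
  (\prod_(r <- rs) ('X - r%:P))^`().[x] =
  (\prod_(r <- rs) ('X - r%:P)).[x] * \sum_(r <- rs) (x - r)^-1.
Proof.
elim: rs => [|r rs IHrs] /=; first by rewrite !big_nil derivC horner0 mulr0.
move=> /andP[rx /IHrs{}IHrs]; rewrite !big_cons derivM derivXsubC mul1r.
rewrite hornerD !hornerM IHrs hornerXsubC.
have : x - r != 0 by rewrite subr_eq0 eq_sym.
by move=> ?; field.
Qed.

(* Partial fractions with nonnegative residues: [g] is the sum of a multiple of [u]
   and of nonnegative multiples of the quotients [u / ('X - r)]. *)
Lemma nevanlinna_ind (P : {poly R} -> Prop) rs g :
  let u := \prod_(r <- rs) ('X - r%:P) in
  (size g <= (size rs).+1)%N -> nevanlinna u g ->
  (forall p q, P p -> P q -> P (p + q)) -> (forall c, P (c *: u)) ->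
  (forall c r w, 0 <= c -> r \in rs -> u = ('X - r%:P) * w -> P (c *: w)) ->
  P g.
Proof.
have [n] := ubnP (size rs); elim: n => // n IHn in P rs g * => rs_lt /=.
set u := \prod_(r <- rs) _ => sg ug PD Pu Pw.
have u_neq0 : u != 0 by rewrite monic_neq0// monic_prod_XsubC.
(* A repeated root [r] of [u] is also a root of [g]: both are divided by ['X - r], and the property
   is transported to multiples of this factor. *)
have [rs_uniq|/not_uniq_perm_cons[r [rs' [rsE r_rs']]]] := boolP (uniq rs); last first.
  have uE : u = ('X - r%:P) * \prod_(r <- rs') ('X - r%:P).
    by rewrite /u (perm_big _ rsE) big_cons.
  have /factor_theorem[g' gE] : root g r.
    apply: nevanlinna_multiple_root u_neq0 ug _.
    by rewrite uE (perm_big _ (perm_to_rem r_rs')) big_cons mulrA expr2 dvdp_mulr.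
  rewrite mulrC in gE; rewrite gE.
  apply: (IHn (fun p => P (('X - r%:P) * p)) rs').
  - by move: rs_lt; rewrite (perm_size rsE).
  - have [->|g'_neq0] := eqVneq g' 0; first by rewrite size_poly0.
    by move: sg; rewrite gE size_monicM ?monicXsubC// size_XsubC (perm_size rsE).
  - by move: ug; rewrite uE gE => /nevanlinna_factor.
  - by move=> p q Pp Pq; rewrite mulrDr; exact: PD.
  - by move=> c; rewrite -scalerAr -uE; exact: Pu.
  - move=> c t w c_ge0 t_rs' wE; rewrite -scalerAr; apply: (Pw _ t) => //.
      by rewrite (perm_mem rsE) inE t_rs' orbT.
    by rewrite uE wE mulrCA.
pose w r := \prod_(s <- rs | s != r) ('X - s%:P).
have uE r : r \in rs -> u = ('X - r%:P) * w r.
  by move=> r_rs; rewrite /u (bigD1_seq r).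
have w0 r s : r \in rs -> s \in rs -> s != r -> (w r).[s] = 0.
  move=> r_rs s_rs sr; apply/rootP.
  by rewrite /w -big_filter root_prod_XsubC mem_filter sr.
have wr r : r \in rs -> (w r).[r] != 0.
  move=> r_rs; rewrite -rootE /w -big_filter root_prod_XsubC.
  by rewrite mem_filter eqxx.
(* The residue of [g / u] at the simple root [r]; the direction ['i] in the local estimate gives its
   sign. *)
pose c r := g.[r] / (w r).[r].
have c_ge0 r : r \in rs -> 0 <= c r.
  move=> r_rs; have := @nevanlinna_local (w r) g r 1 'i.
  rewrite expr1 mulrC -uE// => /(_ ug ltr01); rewrite expr1 /= mulr1 => gw.
  have -> : c r = g.[r] * (w r).[r] / (w r).[r] ^+ 2.
    by rewrite /c; field; exact: wr.
  by rewrite divr_ge0 ?sqr_ge0.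
(* Lagrange interpolation: the leading terms agree, so the two sides differ by a polynomial of size
   at most [size rs] that vanishes on all of [rs]. *)
have gE : g = g`_(size rs) *: u + \sum_(r <- rs) c r *: w r.
  apply/eqP; rewrite -subr_eq0; apply/eqP.
  have sw r : r \in rs -> (size (w r) <= size rs)%N.
    move=> r_rs; have := congr1 (size \o val) (uE r r_rs); rewrite /= size_monicM ?monicXsubC//.
      by rewrite size_XsubC size_prod_XsubC => -[->].
    by move: u_neq0; rewrite (uE r)// mulf_eq0 negb_or => /andP[].
  apply: (@roots_geq_poly_eq0 _ _ rs) => //.
    apply/allP => r r_rs; apply/rootP.
    rewrite hornerD hornerN hornerD hornerZ (uE r)// hornerM hornerXsubC subrr mul0r mulr0 add0r.
    rewrite horner_sum (bigD1_seq r)//= hornerZ /c divfK ?wr// big_seq_cond big1 ?addr0 ?subrr//.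
    by move=> s /andP[s_rs]; rewrite eq_sym => sr; rewrite hornerZ (w0 s r)// mulr0.
  apply/leq_sizeP => j; rewrite leq_eqVlt => /orP[/eqP<-|j_gt].
    rewrite coefB coefD coefZ coef_sum.
    have -> : u`_(size rs) = 1.
      by have /monicP := monic_prod_XsubC rs predT id; rewrite lead_coefE size_prod_XsubC.
    rewrite big_seq big1 ?mulr1 ?addr0 ?subrr// => r r_rs.
    by rewrite coefZ nth_default ?mulr0// sw.
  apply: nth_default; apply: leq_trans j_gt.
  rewrite (leq_trans (size_polyD _ _))// geq_max sg size_polyN.
  rewrite (leq_trans (size_polyD _ _))// geq_max.
  rewrite (leq_trans (size_scale_leq _ _)) ?size_prod_XsubC//=.
  apply: (leq_trans (size_sum _ _ _)); rewrite big_seq; elim/big_ind: _ => //.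
    by move=> a b ? ?; rewrite geq_max; apply/andP.
  by move=> r r_rs; rewrite (leq_trans (size_scale_leq _ _))// leqW// sw.
have P0 : P 0 by have := Pu 0; rewrite scale0r.
rewrite gE; apply: (PD _ _ (Pu _)).
rewrite big_seq; apply: (big_ind P) => // r r_rs.
by apply: (Pw _ r); [exact: c_ge0| |exact: uE].
Qed.

(** * Estimates to the right of the zeros of a real-rooted polynomial *)

Definition real_rooted u := forall t : C, 0 < Im t -> (toC u).[t] != 0.

Lemma nevanlinnaZ c u g : 0 < c -> nevanlinna (c *: u) g -> nevanlinna u g.
Proof.
move=> c_gt0 ug t Imt; have := ug t Imt; rewrite map_polyZ hornerZ /=.
have -> : forall a b : C, a * conj (c%:C * b) = c%:C * (a * conj b).
  move=> [a1 a2] [b1 b2].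
  by apply/eqP; rewrite eq_complex /=; apply/andP; split; apply/eqP; ring.
by rewrite Im_realM pmulr_rle0.
Qed.

Lemma prod_XsubC_gt0 rs x : (forall r, r \in rs -> r < x) ->
  0 < (\prod_(r <- rs) ('X - r%:P)).[x].
Proof.
move=> rs_lt; rewrite horner_prod big_seq prodr_gt0// => r /rs_lt.
by rewrite hornerXsubC subr_gt0.
Qed.

Lemma real_rooted_split u x : real_rooted u -> 0 < lead_coef u ->
  (forall t, x <= t -> u.[t] != 0) ->
  exists rs, u = lead_coef u *: \prod_(r <- rs) ('X - r%:P) /\
             forall r, r \in rs -> r < x.
Proof.
move=> /real_rooted_factor[rs uE] lu ux; exists rs; split=> // r r_rs.
rewrite ltNge; apply/negP => /ux/eqP; apply.
by rewrite uE hornerZ (rootP _) ?mulr0// root_prod_XsubC.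
Qed.

Lemma real_rooted_gt0 u x : real_rooted u -> 0 < lead_coef u ->
  (forall t, x <= t -> u.[t] != 0) -> forall t, x <= t -> 0 < u.[t].
Proof.
move=> uP lu /(real_rooted_split uP lu)[rs [-> rs_lt]] t xt.
by rewrite hornerZ mulr_gt0// prod_XsubC_gt0// => r /rs_lt /lt_le_trans; exact.
Qed.

(** By partial fractions [g / u] is a constant plus nonnegative multiples of the [1 / ('X - r)],
    which decrease to the right of [r]. *)
Lemma nevanlinna_decr u g x y : real_rooted u -> 0 < lead_coef u ->
  (forall t, x <= t -> u.[t] != 0) -> (size g <= size u)%N ->
  nevanlinna u g -> x <= y -> g.[y] * u.[x] <= g.[x] * u.[y].
Proof.
move=> uP lu /(real_rooted_split uP lu)[rs [uE rs_lt]] gu ug xy.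
rewrite uE in ug gu; move/(nevanlinnaZ lu) in ug.
rewrite size_scale ?gt_eqF// size_prod_XsubC in gu.
rewrite uE !hornerZ ![_ * (lead_coef u * _)]mulrCA ler_pM2l//.
move: (nevanlinna_ind (P := fun g => g.[y] * (\prod_(r <- rs) ('X - r%:P)).[x] <=
  g.[x] * (\prod_(r <- rs) ('X - r%:P)).[y]) gu ug).
apply.
- by move=> p q ? ?; rewrite !hornerD !mulrDl lerD.
- by move=> c; rewrite !hornerZ -!mulrA [_.[y] * _]mulrC.
- move=> c r w c_ge0 r_rs wE; rewrite !hornerZ -!mulrA ler_wpM2l// wE !hornerM !hornerXsubC.
  have wx t : x <= t -> 0 < w.[t].
    move=> xt; have rt : r < t by rewrite (lt_le_trans (rs_lt _ r_rs)).
    have := @prod_XsubC_gt0 rs t; rewrite wE hornerM hornerXsubC pmulr_rgt0 ?subr_gt0//.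
    by apply=> s /rs_lt /lt_le_trans; exact.
  rewrite -subr_ge0; have -> : w.[x] * ((y - r) * w.[y]) - w.[y] * ((x - r) * w.[x]) =
    (y - x) * (w.[x] * w.[y]) by ring.
  by rewrite !mulr_ge0 ?subr_ge0// ltW// wx.
Qed.

(** The barrier shift: the new barrier [g' / u'] at [x] does not exceed the old one [g / u] at [y].
    For [g = w = u / ('X - r)] this amounts to [(y - x) * w'(x) <= w(x)], which the hypothesis on
    [u] implies. *)
Lemma nevanlinna_deriv_shift u g x y : real_rooted u -> 0 < lead_coef u ->
  (forall t, x <= t -> u.[t] != 0) -> (size g <= size u)%N ->
  nevanlinna u g -> x <= y -> (y - x) * u^`().[x] <= u.[x] ->
  g^`().[x] * u.[y] <= g.[y] * u^`().[x].
Proof.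
move=> uP lu /(real_rooted_split uP lu)[rs [uE rs_lt]] gu ug xy xu.
rewrite uE in ug gu; move/(nevanlinnaZ lu) in ug.
rewrite size_scale ?gt_eqF// size_prod_XsubC in gu.
move: xu; rewrite uE !derivZ !hornerZ mulrCA ler_pM2l// => xu.
rewrite ![_ * (lead_coef u * _)]mulrCA ler_pM2l//.
move: (nevanlinna_ind (P := fun g => g^`().[x] * (\prod_(r <- rs) ('X - r%:P)).[y] <=
  g.[y] * (\prod_(r <- rs) ('X - r%:P))^`().[x]) gu ug).
apply.
- by move=> p q ? ?; rewrite derivD !hornerD !mulrDl lerD.
- by move=> c; rewrite derivZ !hornerZ -!mulrA [_.[y] * _]mulrC.
- move=> c r w c_ge0 r_rs wE; rewrite derivZ !hornerZ -!mulrA ler_wpM2l//.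
  move: xu; rewrite wE derivM derivXsubC mul1r !hornerD !hornerM !hornerXsubC => xu.
  have wx t : x <= t -> 0 < w.[t].
    move=> xt; have rt : r < t by rewrite (lt_le_trans (rs_lt _ r_rs)).
    have := @prod_XsubC_gt0 rs t; rewrite wE hornerM hornerXsubC pmulr_rgt0 ?subr_gt0//.
    by apply=> s /rs_lt /lt_le_trans; exact.
  have wx0 := wx x (lexx _); have wy0 := wx y xy.
  have rx : 0 < x - r by rewrite subr_gt0 rs_lt.
  have : (y - x) * w^`().[x] <= w.[x].
    rewrite -(ler_pM2l rx); apply: le_trans xu.
    by rewrite mulrCA mulrDr lerDr mulr_ge0 ?subr_ge0// ltW.
  move=> wyx; rewrite -subr_ge0.
  have -> : forall a c d : R, c * (a + (x - r) * d) - d * ((y - r) * c) =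
    c * (a - (y - x) * d) by move=> *; ring.
  by rewrite mulr_ge0 ?subr_ge0 ?(ltW wy0).
Qed.

Lemma coef_prod_sum_roots rs c n : n = size rs -> (0 < n)%N ->
  (c *: \prod_(r <- rs) ('X - r%:P))`_n = c /\
  (c *: \prod_(r <- rs) ('X - r%:P))`_n.-1 = - (c * \sum_(r <- rs) r).
Proof.
move=> -> n_gt0; rewrite !coefZ coefPn_prod_XsubC -?lt0n// mulrN; split=> //.
have /monicP := monic_prod_XsubC rs predT id; rewrite lead_coefE size_prod_XsubC /= => ->.
by rewrite mulr1.
Qed.

(** Nonnegative zeros of sum at most [n * mu] all lie in [[0, n * mu]]. The point [mu * (2 * n + 2)]
    is where a barrier at [mu * (2 * n + 4)] arrives after a move of [2 * mu]. *)
Lemma bound_from_mean_root u n mu : real_rooted u -> 0 < lead_coef u ->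
  size u = n.+1 -> (0 < n)%N -> 0 < mu ->
  (forall t, t < 0 -> u.[t] != 0) -> - u`_n.-1 <= n%:R * mu * u`_n ->
  (forall t, n%:R * mu < t -> u.[t] != 0) /\
  2 * mu * u^`().[mu * (2 * n%:R + 2)] <= u.[mu * (2 * n%:R + 2)].
Proof.
move=> uP lu su n_gt0 mu_gt0 u_neg.
have [rs uE] := real_rooted_factor uP.
have rsn : n = size rs.
  by move: su; rewrite uE size_scale ?gt_eqF// size_prod_XsubC => -[].
have rs_ge0 r : r \in rs -> 0 <= r.
  move=> r_rs; rewrite leNgt; apply/negP => /u_neg/eqP; apply.
  by rewrite uE hornerZ (rootP _) ?mulr0// root_prod_XsubC.
rewrite uE; have [-> ->] := coef_prod_sum_roots (lead_coef u) rsn n_gt0.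
rewrite opprK mulrC ler_pM2r// => sum_le.
have rs_le r : r \in rs -> r <= n%:R * mu.
  move=> r_rs; apply: le_trans sum_le; rewrite (perm_big _ (perm_to_rem r_rs)) big_cons /=.
  rewrite lerDl big_seq sumr_ge0// => s /mem_rem; exact: rs_ge0.
split=> [t t_gt|].
  rewrite hornerZ mulf_neq0 ?gt_eqF// prod_XsubC_gt0// => r /rs_le /le_lt_trans; exact.
have n1 : 1 <= n%:R :> R by rewrite ler1n.
have [x xE] : {x | x = mu * (2 * n%:R + 2)} by exists (mu * (2 * n%:R + 2)).
rewrite -xE; have xn : n%:R * mu < x by rewrite xE; nra.
have x_gt0 : 0 < x by rewrite xE; nra.
rewrite derivZ !hornerZ mulrCA ler_pM2l// horner_prod_XsubC_deriv; last first.
  by apply/allP => r /rs_le rn; rewrite lt_eqF// (le_lt_trans rn).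
rewrite mulrCA ger_pMr; last by rewrite prod_XsubC_gt0// => r /rs_le /le_lt_trans; exact.
(* On [[0, n * mu]] the convex function [1 / (x - r)] of [r] lies below its chord. *)
have step r : r \in rs -> (x - r)^-1 <= x^-1 + r * (x * (x - n%:R * mu))^-1.
  move=> r_rs; have := rs_le r r_rs; have := rs_ge0 r r_rs => r0 rn.
  have xr : 0 < x - r by lra.
  have xm : 0 < x - n%:R * mu by lra.
  have -> : (x - r)^-1 = x^-1 + r * (x * (x - r))^-1.
    by field; rewrite !gt_eqF.
  rewrite lerD2l ler_wpM2l// lef_pV2 ?posrE ?mulr_gt0//.
  by apply: ler_wpM2l; lra.
have : \sum_(r <- rs) (x - r)^-1 <= n%:R * x^-1 + (n%:R * mu) * (x * (x - n%:R * mu))^-1.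
  apply: (@le_trans _ _ (\sum_(r <- rs) (x^-1 + r * (x * (x - n%:R * mu))^-1))).
    by rewrite big_seq [leRHS]big_seq; apply: ler_sum.
  rewrite big_split /= big_const_seq count_predT -rsn iter_addr_0.
  rewrite -[x^-1 *+ n]mulr_natl lerD2l -mulr_suml.
  by rewrite ler_wpM2r// invr_ge0 mulr_ge0 ?subr_ge0// ltW.
move=> /(ler_wpM2l (_ : 0 <= 2 * mu)) -/(_ _)/wrap[|sum2]; first lra.
apply: (le_trans sum2).
have -> : 2 * mu * (n%:R * x^-1 + n%:R * mu * (x * (x - n%:R * mu))^-1) =
  (n%:R ^+ 2 + 3 * n%:R) / ((n%:R + 1) * (n%:R + 2)).
  by rewrite xE; field; rewrite !gt_eqF//; nra.
by rewrite ler_pdivrMr; nra.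
Qed.

(** The tangent at [0], [1 / (a - r) >= 1 / a + r / a ^ 2], turns a bound on the logarithmic
    derivative into one on the sum of the zeros. For [mu = a / (a ^ 2 - 1)] one has
    [a ^ 2 * mu = a + mu], so the same [mu] serves in both bounds. *)
Lemma mean_root_from_bound u n a : real_rooted u -> 0 < lead_coef u ->
  size u = n.+1 -> (0 < n)%N -> 1 < a -> (forall t, a <= t -> u.[t] != 0) ->
  (forall t, t < 0 -> u.[t] != 0) ->
  u^`().[a] <= n%:R * (a / (a ^+ 2 - 1)) * u.[a] ->
  - u`_n.-1 <= n%:R * (a / (a ^+ 2 - 1)) * u`_n.
Proof.
move=> uP lu su n_gt0 a1 ua u_neg; set mu := a / _.
have [rs [uE rs_lt]] := real_rooted_split uP lu ua.
have rsn : n = size rs.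
  by move: su; rewrite uE size_scale ?gt_eqF// size_prod_XsubC => -[].
have rs_ge0 r : r \in rs -> 0 <= r.
  move=> r_rs; rewrite leNgt; apply/negP => /u_neg/eqP; apply.
  by rewrite uE hornerZ (rootP _) ?mulr0// root_prod_XsubC.
rewrite uE; have [-> ->] := coef_prod_sum_roots (lead_coef u) rsn n_gt0.
rewrite opprK derivZ !hornerZ mulrCA ler_pM2l// horner_prod_XsubC_deriv; last first.
  by apply/allP => r /rs_lt ra; rewrite lt_eqF.
rewrite [leRHS]mulrC ler_pM2l ?prod_XsubC_gt0// => sum_le.
rewrite mulrC ler_pM2r//.
have step r : r \in rs -> a^-1 + r * a ^- 2 <= (a - r)^-1.
  move=> r_rs; have ra : 0 < a - r by rewrite subr_gt0 rs_lt.
  have -> : (a - r)^-1 = a^-1 + r * a ^- 2 + r ^+ 2 / (a ^+ 2 * (a - r)).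
    by field; rewrite !gt_eqF//; lra.
  by rewrite lerDl divr_ge0 ?sqr_ge0// mulr_ge0 ?sqr_ge0// ltW.
have : n%:R * a^-1 + (\sum_(r <- rs) r) * a ^- 2 <= n%:R * mu.
  apply: le_trans sum_le.
  apply: (@le_trans _ _ (\sum_(r <- rs) (a^-1 + r * a ^- 2))).
    rewrite big_split /= big_const_seq count_predT -rsn iter_addr_0.
    by rewrite -[a^-1 *+ n]mulr_natl -mulr_suml.
  by rewrite big_seq [leRHS]big_seq; apply: ler_sum.
have a0 : 0 < a by lra.
move=> /(ler_wpM2l (_ : 0 <= a ^+ 2)) -/(_ _)/wrap[|]; first exact: sqr_ge0.
have -> : a ^+ 2 * (n%:R / a + (\sum_(r <- rs) r) / a ^+ 2) = n%:R * a + \sum_(r <- rs) r.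
  by field; rewrite gt_eqF.
have -> : a ^+ 2 * (n%:R * mu) = n%:R * a + n%:R * mu.
  by rewrite /mu; field; rewrite gt_eqF//; nra.
by rewrite lerD2l.
Qed.
End Univariate.

(** * Principal minors of a pencil and their derivatives *)

Definition upd (T : eqType) (V : Type) (f : T -> V) (j : T) (t : V) : T -> V :=
  fun k => if k == j then t else f k.

Section Pencil.
Variables (R : rcfType) (n r : nat) (A : 'M[R[i]]_n).
Local Notation C := R[i].
Local Notation Re := (@complex.Re R).
Local Notation Im := (@complex.Im R).
Local Notation conj := (@conjc R).
Local Notation J := ('I_n * 'I_r)%type.
Implicit Types (S : {set 'I_n}) (x : 'I_n -> C) (Q : {set J}) (z : J -> C)
  (s : seq 'I_n) (i k : 'I_n) (c : 'I_r) (j : J).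

(* The rows and columns indexed by [S] are replaced by those of the identity,
   so that the determinant is the principal minor on the complement of [S]. *)
Definition pencil S x : 'M[C]_n :=
  \matrix_(i, k) if (i \in S) || (k \in S) then (i == k)%:R
                 else x i *+ (i == k) - A i k.

Definition minor S x : C := \det (pencil S x).

Lemma eq_minor S x y : x =1 y -> minor S x = minor S y.
Proof. by move=> xy; congr (\det _); apply/matrixP => i k; rewrite !mxE xy. Qed.

(** The determinant is affine in [x k], which occurs in a single diagonal entry; the slope is the
    minor in which [k] is deleted too. *)
Lemma minor_upd S x k t : minor S (upd x k t) =
  minor S x + (t - x k) * (if k \in S then 0 else minor (k |: S) x).
Proof.
have [kS|kS] := ifPn; rewrite /minor.
  rewrite mulr0 addr0; congr (\det _); apply/matrixP => i l; rewrite !mxE /upd.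
  by have [->|_] := eqVneq i k; rewrite ?kS.
pose B : 'M[C]_n := \matrix_(i, l) if i == k then (k == l)%:R else pencil S x i l.
rewrite -[X in X + _]mul1r (@determinant_multilinear _ _ _ (pencil S x) B k 1 (t - x k)).
- congr (_ + _ * _); rewrite !(expand_det_row _ k); apply: eq_bigr => l _.
  rewrite !mxE eqxx !inE eqxx /=; case: (eqVneq k l) => [<-|]; last by rewrite !mul0r.
  congr (_ * (_ * \det _)); apply/matrixP => i m; rewrite !mxE.
  by rewrite !inE -![lift _ _ == k]eq_sym !(negbTE (neq_lift _ _)).
- apply/rowP => l; rewrite !mxE /upd eqxx (negbTE kS) /=.
  case: (boolP (l \in S)) => lS; last by rewrite mul1r; case: eqP => _ /=; ring.
  have /negbTE -> : k != l by apply: contraNneq kS => ->.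
  by rewrite !mulr0 addr0.
- by apply/matrixP => i l; rewrite !mxE /upd ?[lift _ _ == k]eq_sym ?(negbTE (neq_lift _ _)).
- by apply/matrixP => i l; rewrite !mxE /upd ?[lift _ _ == k]eq_sym ?(negbTE (neq_lift _ _)).
Qed.

Lemma minor_setT x : minor setT x = 1.
Proof.
rewrite -(det1 C n); congr (\det _); apply/matrixP => i k.
by rewrite !mxE inE.
Qed.

Lemma mulmx_pencil S x (v : 'rV[C]_n) k : (v *m pencil S x) 0 k =
  if k \in S then v 0 k
  else v 0 k * x k - \sum_(i | i \notin S) v 0 i * A i k.
Proof.
rewrite mxE; case: ifPn => [kS|kS].
  rewrite (bigD1 k)//= big1 => [|i ik]; first by rewrite !mxE kS orbT eqxx mulr1 addr0.
  by rewrite !mxE kS orbT (negbTE ik) mulr0.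
rewrite (bigID (fun i => i \in S))/= big1 ?add0r; last first.
  move=> i iS; rewrite !mxE iS /=.
  have /negbTE -> : i != k by apply: contraNneq kS => <-.
  by rewrite mulr0.
rewrite (eq_bigr (fun i => v 0 i * x i *+ (i == k) - v 0 i * A i k)); last first.
  by move=> i iS; rewrite !mxE (negbTE iS) (negbTE kS) /= mulrBr mulrnAr.
rewrite sumrB; congr (_ - _); rewrite (bigD1 k)//= eqxx mulr1n big1 ?addr0//.
by move=> i /andP[_ /negbTE ->].
Qed.

Lemma mulmx_supported S (v : 'rV[C]_n) k : (forall k, k \in S -> v 0 k = 0) ->
  (v *m A) 0 k = \sum_(i | i \notin S) v 0 i * A i k.
Proof.
move=> vS; rewrite mxE (bigID (fun i => i \in S))/= big1 ?add0r// => i /vS ->.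
by rewrite mul0r.
Qed.

Lemma pencil_kerP S x (v : 'rV[C]_n) :
  v *m pencil S x = 0 <->
  (forall k, k \in S -> v 0 k = 0) /\
  (forall k, k \notin S -> v 0 k * x k = (v *m A) 0 k).
Proof.
split=> [v0|[vS vN]].
  have vS k : k \in S -> v 0 k = 0.
    by move=> kS; have := mulmx_pencil S x v k; rewrite v0 mxE kS => <-.
  split=> // k kS; have := mulmx_pencil S x v k; rewrite v0 mxE (negbTE kS) -mulmx_supported//.
  by move/eqP; rewrite eq_sym subr_eq0 => /eqP.
apply/rowP => k; rewrite mulmx_pencil mxE; case: ifPn => [/vS//|kS].
by rewrite vN// -mulmx_supported// subrr.
Qed.

Definition hermitian := forall i k, conj (A i k) = A k i.

Definition sqnorm (w : C) : R := Re w ^+ 2 + Im w ^+ 2.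

Lemma sqnorm_ge0 w : 0 <= sqnorm w.
Proof. by rewrite addr_ge0 ?sqr_ge0. Qed.

Lemma sqnorm_eq0 w : (sqnorm w == 0) = (w == 0).
Proof.
by rewrite paddr_eq0 ?sqr_ge0// !sqrf_eq0 eq_complex.
Qed.

Lemma mul_conj w : w * conj w = (sqnorm w)%:C.
Proof.
case: w => a b; apply/eqP; rewrite eq_complex /= /sqnorm /=.
by apply/andP; split; apply/eqP; ring.
Qed.

Lemma Re_sum (I : Type) (l : seq I) (P : pred I) (F : I -> C) :
  Re (\sum_(i <- l | P i) F i) = \sum_(i <- l | P i) Re (F i).
Proof. by elim/big_rec2 : _ => // i a b _ <-; case: (F i) b => ? ? []. Qed.

Lemma Im_sum (I : Type) (l : seq I) (P : pred I) (F : I -> C) :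
  Im (\sum_(i <- l | P i) F i) = \sum_(i <- l | P i) Im (F i).
Proof. by elim/big_rec2 : _ => // i a b _ <-; case: (F i) b => ? ? []. Qed.

Lemma Im_qform (v : 'rV[C]_n) : hermitian ->
  Im (\sum_k (v *m A) 0 k * conj (v 0 k)) = 0.
Proof.
move=> hA; suff : conj (\sum_k (v *m A) 0 k * conj (v 0 k)) =
    \sum_k (v *m A) 0 k * conj (v 0 k).
  by case: (\sum_k _) => a b [] /eqP; rewrite eq_sym -addr_eq0 -mulr2n mulrn_eq0 => /eqP.
rewrite rmorph_sum /=.
under eq_bigr do rewrite mxE rmorphM /= conjcK rmorph_sum /= mulr_suml.
under [RHS]eq_bigr do rewrite mxE mulr_suml.
rewrite exchange_big; apply: eq_bigr => i _; apply: eq_bigr => k _ /=.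
by rewrite rmorphM /= hA; ring.
Qed.

(** For a kernel vector [v], pairing with [v] equates [\sum_k |v_k|^2 * x_k] with the form of [A] at
    [v], which is real; taking imaginary parts forces [v = 0]. *)
Lemma minor_neq0 S x : hermitian -> (forall i, 0 < Im (x i)) -> minor S x != 0.
Proof.
move=> hA xIm; apply/det0P => -[v v_neq0 /pencil_kerP[vS vN]].
move/negP: v_neq0; apply; apply/eqP/rowP => k; rewrite mxE.
have : \sum_k v 0 k * x k * conj (v 0 k) = \sum_k (v *m A) 0 k * conj (v 0 k).
  apply: eq_bigr => i _; have [/vS ->|/vN ->//] := boolP (i \in S).
  by rewrite rmorph0 !mulr0.
move=> /(congr1 Im); rewrite Im_qform// Im_sum.
under eq_bigr do rewrite mulrAC mul_conj Im_realM.
have p_ge0 i : 0 <= sqnorm (v 0 i) * Im (x i) by rewrite mulr_ge0 ?sqnorm_ge0// ltW.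
move=> /eqP; rewrite psumr_eq0// => /allP /(_ k (mem_index_enum _)).
by rewrite mulf_eq0 sqnorm_eq0 [Im _ == 0]gt_eqF// orbF => /eqP.
Qed.

Lemma minor_conj S x : hermitian -> conj (minor S x) = minor S (conj \o x).
Proof.
move=> hA; rewrite /minor -det_tr -[LHS]det_map_mx; congr (\det _).
apply/matrixP => i k; rewrite !mxE [k == i]eq_sym [(k \in S) || _]orbC.
case: ifP => _; first by case: eqP => _; rewrite ?rmorph0 ?rmorph1.
rewrite rmorphB /= hA; congr (_ - _).
by case: eqP => [->|_]; rewrite ?mulr1n ?mulr0n ?rmorph0.
Qed.

Definition slice Q c : {set 'I_n} := [set i | (i, c) \in Q].

Definition minor_prod Q z : C := \prod_c minor (slice Q c) (fun i => z (i, c)).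

(* [pderivs s Q z] is the derivative along the list of directions [s] of the
   product over [c] of the determinants of [diag (z (_, c)) - A], after deriving
   once in every variable of [Q]; the direction [i] stands for the sum of the
   partial derivatives in the variables [(i, c)]. *)
Fixpoint pderivs s Q z : C :=
  if s is i :: s' then \sum_(c | (i, c) \notin Q) pderivs s' ((i, c) |: Q) z
  else minor_prod Q z.

Lemma eq_pderivs s Q z z' : z =1 z' -> pderivs s Q z = pderivs s Q z'.
Proof.
move=> zz'; elim: s Q => [|i s IHs] Q /=.
  by apply: eq_bigr => c _; apply: eq_minor => i.
by apply: eq_bigr => c _.
Qed.

Lemma pderivs_upd s Q z j t : pderivs s Q (upd z j t) =
  pderivs s Q z + (t - z j) * (if j \in Q then 0 else pderivs s (j |: Q) z).
Proof.
elim: s Q => [|i s IHs] Q /=.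
  case: j => k c0; rewrite /minor_prod (bigD1 c0)//= [in RHS](bigD1 c0)//=.
  rewrite (_ : minor _ _ = minor (slice Q c0) (upd (fun i => z (i, c0)) k t)); last first.
    by apply: eq_minor => i; rewrite /upd xpair_eqE eqxx andbT.
  rewrite minor_upd inE.
  rewrite [X in _ * X = _](eq_bigr (fun c => minor (slice Q c) (fun i => z (i, c)))); last first.
    move=> c cc0; apply: eq_minor => i.
    by rewrite /upd xpair_eqE (negbTE cc0) andbF.
  case: ifP => [_|kQ]; first by rewrite !mulr0 !addr0.
  rewrite [X in _ = _ + _ * X](bigD1 c0)//= mulrDl -mulrA; congr (_ + _ * (_ * _)).
    by congr minor; apply/setP => i; rewrite !inE xpair_eqE eqxx andbT.
  apply: eq_bigr => c cc0; congr minor.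
  by apply/setP => i; rewrite !inE xpair_eqE (negbTE cc0) andbF.
under eq_bigr do rewrite IHs; rewrite big_split /=; congr (_ + _).
rewrite -big_distrr /=; congr (_ * _); case: ifP => [jQ|jQ].
  by apply: big1 => c _; rewrite !inE jQ orbT.
rewrite big_mkcond [RHS]big_mkcond; apply: eq_bigr => c _.
rewrite !inE jQ orbF negb_or [(i, c) == j]eq_sym.
by rewrite setUCA; case: (j == (i, c)); case: ((i, c) \notin Q).
Qed.

Lemma pderivs_conj s Q z : hermitian -> conj (pderivs s Q z) = pderivs s Q (conj \o z).
Proof.
move=> hA; elim: s Q => [|i s IHs] Q /=; last first.
  by rewrite rmorph_sum; apply: eq_bigr => c _; exact: IHs.
by rewrite rmorph_prod; apply: eq_bigr => c _; exact: minor_conj.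
Qed.

Lemma pderivs_perm s s' Q z : perm_eq s s' -> pderivs s Q z = pderivs s' Q z.
Proof.
have swap i k t Q' : pderivs [:: i, k & t] Q' z = pderivs [:: k, i & t] Q' z.
  rewrite /= (exchange_big_dep (fun c => (k, c) \notin Q'))/=; last first.
    by move=> c d _; rewrite inE negb_or => /andP[].
  apply: eq_bigr => d dQ; apply: eq_big => [c|c _]; last by rewrite setUCA.
  by rewrite !inE !negb_or dQ andbT [(k, d) == _]eq_sym andbC.
have front i t Q' : i \in t -> pderivs t Q' z = pderivs (i :: rem i t) Q' z.
  elim: t Q' => // k t IHt Q'; have [->|ki] := eqVneq k i; first by rewrite /= eqxx.
  rewrite inE eq_sym (negbTE ki) [rem _ _]/= (negbTE ki) => it; rewrite swap.
  by apply: eq_bigr => c _; exact: IHt.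
elim: s s' Q => [|i s IHs] s' Q ss'; first by move: ss'; rewrite perm_sym => /perm_nilP ->.
have is' : i \in s' by rewrite -(perm_mem ss') mem_head.
rewrite (front i s')//; apply: eq_bigr => c _; apply: IHs.
by rewrite -(perm_cons i) (perm_trans ss')// perm_to_rem.
Qed.

Definition card_fiber Q i : nat := #|[set c | (i, c) \in Q]|.

Lemma card_fiberU1 Q j i : j \notin Q ->
  card_fiber (j |: Q) i = (card_fiber Q i + (j.1 == i))%N.
Proof.
case: j => k c /= jQ; rewrite /card_fiber; have [<-|ki] := eqVneq k i.
  have -> : nat_of_bool true = (c \notin [set d | (k, d) \in Q]) by rewrite inE jQ.
  rewrite addnC -cardsU1; apply: eq_card => d; rewrite !inE xpair_eqE eqxx.
  by case: eqP.
rewrite addn0; apply: eq_card => d; rewrite !inE xpair_eqE [i == k]eq_sym.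
by rewrite (negbTE ki).
Qed.

(** The product is affine in each of the [r] copies of a coordinate, so more than [r] derivations in
    one direction, counted in [Q] and [s] together, give [0]. *)
Definition admissible s Q := forall i, (card_fiber Q i + count_mem i s <= r)%N.

Lemma card_fiber_le Q i : (card_fiber Q i <= r)%N.
Proof. by rewrite -[leqRHS]card_ord max_card. Qed.

Lemma mem_full_fiber Q i c : card_fiber Q i = r -> (i, c) \in Q.
Proof.
move=> full; have : [set d | (i, d) \in Q] == setT.
  rewrite eqEcard subsetT cardsT card_ord.
  by rewrite [(r <= _)%N](_ : _ = (r <= card_fiber Q i)%N)// full leqnn.
by move=> /eqP/setP/(_ c); rewrite !inE.
Qed.

Lemma admissible_cons i s Q c : admissible (i :: s) Q -> (i, c) \notin Q ->
  admissible s ((i, c) |: Q).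
Proof. by move=> iQ cQ k; have := iQ k; rewrite card_fiberU1//= addnA. Qed.

Lemma admissible_behead i s Q : admissible (i :: s) Q -> admissible s Q.
Proof. by move=> iQ k; have := iQ k; rewrite /= addnCA; apply: leq_trans; rewrite leq_addl. Qed.

Lemma exists_free_copy Q i : (card_fiber Q i < r)%N -> exists c, (i, c) \notin Q.
Proof.
move=> lt; apply/existsP; apply: contraTT lt => /existsPn Qall.
rewrite -leqNgt -[leqLHS]card_ord subset_leq_card//; apply/subsetP => c _.
by rewrite inE -[_ \in _]negbK Qall.
Qed.

Lemma pderivs_overfull s Q z i : (r < card_fiber Q i + count_mem i s)%N ->
  pderivs s Q z = 0.
Proof.
elim: s Q => [|k s IHs] Q /=; first by rewrite addn0 ltnNge card_fiber_le.
move=> lt; apply: big1 => c cQ; apply: IHs.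
by rewrite card_fiberU1//= -addnA.
Qed.

(** Stability passes to directional derivatives as in the Gauss-Lucas theorem: each quotient [q c]
    of a partial derivative by the function has negative imaginary part, hence so does their sum. *)
Lemma pderivs_neq0 s Q z : hermitian -> admissible s Q -> (forall j, 0 < Im (z j)) ->
  pderivs s Q z != 0.
Proof.
move=> hA; elim: s Q z => [|i s IHs] Q z adm zIm /=.
  by apply/prodf_neq0 => c _; apply: minor_neq0.
have f_neq0 := IHs _ _ (admissible_behead adm) zIm.
have h_neq0 c : (i, c) \notin Q -> pderivs s ((i, c) |: Q) z != 0.
  by move=> cQ; apply: IHs => //; exact: admissible_cons.
pose q c := pderivs s ((i, c) |: Q) z / pderivs s Q z.
have q_lt0 c : (i, c) \notin Q -> Im (q c) < 0.
  (* The function, affine in the variable [(i, c)], vanishes at [t], which would lie in the upper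
     half plane if [Im (q c)] were nonnegative. *)
  move=> cQ; pose t := z (i, c) - (q c)^-1.
  have : pderivs s Q (upd z (i, c) t) = 0.
    rewrite pderivs_upd (negbTE cQ) /t /q; field.
    by rewrite f_neq0 h_neq0.
  move=> ft0; rewrite ltNge; apply/negP => q_ge0.
  have /eqP := ft0; apply/negP; apply: IHs => [|j]; first exact: admissible_behead adm.
  rewrite /upd; case: eqP => // _; rewrite /t.
  have : q c != 0 by rewrite mulf_neq0 ?invr_neq0 ?h_neq0.
  have := zIm (i, c); case: (z _) (q c) q_ge0 => a b [a' b'] /= b'0 b0.
  rewrite eq_complex /= -[_ && _]/(_ && _) => ab.
  have d_gt0 : 0 < a' ^+ 2 + b' ^+ 2.
    by rewrite lt0r addr_ge0 ?sqr_ge0// andbT paddr_eq0 ?sqr_ge0// !sqrf_eq0.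
  have : 0 <= b' / (a' ^+ 2 + b' ^+ 2) by rewrite divr_ge0// ltW.
  lra.
have [c cQ] : exists c, (i, c) \notin Q.
  apply: exists_free_copy; apply: leq_trans (adm i).
  by rewrite /= eqxx addnA addn1 ltnS leq_addr.
rewrite (eq_bigr (fun c => pderivs s Q z * q c)); last first.
  by move=> d _; rewrite /q mulrC divfK.
rewrite -mulr_sumr mulf_neq0//; apply/eqP => /(congr1 Im); rewrite Im_sum.
apply/eqP; rewrite lt_eqF// (bigD1 c)//= ltr_wnDr ?q_lt0//.
by apply: sumr_le0 => d /andP[dQ _]; rewrite ltW// q_lt0.
Qed.
End Pencil.

(** * Stability and negative dependence *)

Section Stability.
Variables (R : rcfType) (n r : nat) (A : 'M[R[i]]_n).
Local Notation C := R[i].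
Local Notation Re := (@complex.Re R).
Local Notation Im := (@complex.Im R).
Local Notation conj := (@conjc R).
Local Notation toC := (map_poly (real_complex R)).
Local Notation J := ('I_n * 'I_r)%type.
Implicit Types (S : {set 'I_n}) (x y : 'I_n -> R) (Q : {set J}) (z : J -> C)
  (s : seq 'I_n) (i : 'I_n) (c : 'I_r) (j : J).
Local Notation pderivs := (@pderivs R n r A).
Hypothesis hA : hermitian A.

Lemma polyfun_pderivs s Q z :
  polyfun (fun e => pderivs s Q (fun j => z j + e%:C * 'i)).
Proof.
elim: s Q => [|i s IHs] Q /=; last by apply: polyfun_sum => c _.
apply: polyfun_prod => c _; apply: polyfun_det => i k.
apply: (eq_polyfun (f := fun e => if (i \in slice Q c) || (k \in slice Q c)
   then (i == k)%:R else (z (i, c) + e%:C * 'i) *+ (i == k) - A i k)).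
  by move=> e; rewrite !mxE.
case: ((i \in slice Q c) || (k \in slice Q c)); first exact: polyfun_cst.
apply: polyfunD; last exact: polyfun_cst.
case: (i == k); last exact: polyfun_cst.
apply: polyfunD; first exact: polyfun_cst.
by apply: polyfunM; [exact: polyfun_id|exact: polyfun_cst].
Qed.

Lemma admissibleU1 s Q j : admissible s (j |: Q) -> admissible s Q.
Proof.
move=> adm i; apply: leq_trans (adm i); rewrite leq_add2r subset_leq_card//.
by apply/subsetP => c; rewrite !inE => ->; rewrite orbT.
Qed.

(** The function [f] is affine in [z j] with slope [h]; its zero [z j - f / h] is not in the open
    upper half plane, which says that [Im (f / h) >= Im (z j)]. *)
Lemma pderivs_nevanlinna_open s Q z j : admissible s (j |: Q) -> j \notin Q ->
  (forall k, 0 < Im (z k)) ->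
  Im (z j) * sqnorm (pderivs s (j |: Q) z) <=
  Im (pderivs s Q z * conj (pderivs s (j |: Q) z)).
Proof.
move=> adm jQ zIm; set f := pderivs s Q z; set h := pderivs s _ z.
have h_neq0 : h != 0 by exact: pderivs_neq0.
have -> : f * conj h = (sqnorm h)%:C * (f / h).
  by rewrite -mul_conj; field.
rewrite Im_realM mulrC ler_wpM2l ?sqnorm_ge0//.
rewrite leNgt; apply/negP => lt.
have : pderivs s Q (upd z j (z j - f / h)) = 0.
  by rewrite pderivs_upd (negbTE jQ) -/f -/h; field.
apply/eqP; apply: pderivs_neq0 => // [|k]; first exact: admissibleU1 adm.
rewrite /upd; case: eqP => // _; move: lt.
by case: (z j) (f / h) => a b [a' b'] /=; lra.
Qed.

(** Limit of the open case along [z + e * 'i]; multiplied by [|h|^2], the inequality keeps a meaning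
    where [h] vanishes. *)
Lemma pderivs_nevanlinna s Q z j : admissible s (j |: Q) -> j \notin Q ->
  (forall k, 0 <= Im (z k)) ->
  Im (z j) * sqnorm (pderivs s (j |: Q) z) <=
  Im (pderivs s Q z * conj (pderivs s (j |: Q) z)).
Proof.
move=> adm jQ zIm.
pose ze e k := z k + e%:C * 'i.
have Imze e k : Im (ze e k) = Im (z k) + e.
  by rewrite /ze; case: (z k) => a b /=; ring.
pose f e := pderivs s Q (ze e); pose h e := pderivs s (j |: Q) (ze e).
pose F e := f e * conj (h e) - ze e j * (h e * conj (h e)).
have FE e : Im (F e) = Im (f e * conj (h e)) - Im (ze e j) * sqnorm (h e).
  rewrite /F mul_conj [ze e j * _]mulrC.
  have -> : Im (ze e j) * sqnorm (h e) = Im ((sqnorm (h e))%:C * ze e j).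
    by rewrite Im_realM mulrC.
  by case: (_ * _) (_ * ze e j) => a b [].
have FP : polyfun F.
  have hP := polyfun_pderivs s (j |: Q) z.
  apply: polyfunD.
    apply: polyfunM; first exact: polyfun_pderivs.
    exact: polyfun_conj.
  apply: polyfunN; apply: polyfunM; last by apply: polyfunM => //; exact: polyfun_conj.
  apply: polyfunD; first exact: polyfun_cst.
  by apply: polyfunM; [exact: polyfun_id|exact: polyfun_cst].
have ze0 : ze 0 =1 z by move=> k; rewrite /ze rmorph0 mul0r addr0.
have := polyfun_Im_ge0 FP; rewrite FE /f /h !(eq_pderivs _ _ _ ze0) ze0 subr_ge0; apply.
move=> e e_gt0; rewrite FE subr_ge0; apply: pderivs_nevanlinna_open => // k.
by rewrite Imze ltr_wpDl.
Qed.

Definition realpt y : J -> C := fun j => (y j.1)%:C.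

Definition rpderivs s Q y : R := Re (pderivs s Q (realpt y)).

Lemma pderivs_real s Q z : (forall j, conj (z j) = z j) ->
  pderivs s Q z = (Re (pderivs s Q z))%:C.
Proof.
move=> zR; have := pderivs_conj s Q z hA.
rewrite (@eq_pderivs _ _ _ _ _ _ (conj \o z) z zR).
by case: (pderivs s Q z) => a b [] /eqP; rewrite eq_sym -addr_eq0 -mulr2n mulrn_eq0 => /eqP ->.
Qed.

Lemma pderivs_realpt s Q y : pderivs s Q (realpt y) = (rpderivs s Q y)%:C.
Proof. by apply: pderivs_real => j; exact: conjc_real. Qed.

Lemma rpderivs_cons i s Q y :
  rpderivs (i :: s) Q y = \sum_(c | (i, c) \notin Q) rpderivs s ((i, c) |: Q) y.
Proof. by rewrite /rpderivs /= Re_sum. Qed.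

(** With [z j] real and the copy [k] moved by ['i], the half plane inequality is applied to
    [f + f_k * 'i] and its derivative [f_j + f_jk * 'i]; the imaginary part is the claim. *)
Lemma rpderivs_rayleigh s Q y j k : admissible s (j |: Q) -> j \notin Q ->
  k \notin Q -> j != k ->
  rpderivs s Q y * rpderivs s (k |: (j |: Q)) y <=
  rpderivs s (j |: Q) y * rpderivs s (k |: Q) y.
Proof.
move=> adm jQ kQ jk; have := @pderivs_nevanlinna s Q (upd (realpt y) k ((y k.1)%:C + 'i)) j adm jQ.
rewrite {2}/upd (negbTE jk) /= mul0r !pderivs_upd (negbTE kQ).
rewrite !inE eq_sym (negbTE jk) (negbTE kQ) /=.
have -> : (y k.1)%:C + 'i - realpt y k = 'i by rewrite /realpt addrC addKr.
rewrite !pderivs_realpt => /(_ _)/wrap[|].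
  by move=> l; rewrite /upd; case: ifP => _ /=; lra.
by rewrite /=; lra.
Qed.

(* [y] is above the zeros of [pderivs s Q]: by stability this is the positivity of
   all the further partial derivatives that are not identically zero. *)
Definition above s Q y := forall Q', Q \subset Q' -> admissible s Q' ->
  0 < rpderivs s Q' y.

Lemma above_subset s Q Q' y : Q \subset Q' -> above s Q y -> above s Q' y.
Proof. by move=> QQ' ab Q'' /(subset_trans QQ'); exact: ab. Qed.

Lemma above_cons i s Q y : above s Q y -> above (i :: s) Q y.
Proof.
move=> ab Q' QQ' adm; rewrite rpderivs_cons.
have [c cQ] : exists c, (i, c) \notin Q'.
  apply: exists_free_copy; apply: leq_trans (adm i).
  by rewrite /= eqxx addnA addn1 ltnS leq_addr.
have pos d : (i, d) \notin Q' -> 0 < rpderivs s ((i, d) |: Q') y.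
  move=> dQ; apply: ab; last exact: admissible_cons.
  by rewrite (subset_trans QQ')// subsetU1.
rewrite (bigD1 c)//= ltr_pwDl ?pos// sumr_ge0// => d /andP[dQ _].
by rewrite ltW// pos.
Qed.

(** Removing some [k] from [Q'], the Rayleigh inequality for [j] and [k] bounds the unknown
    derivative from below by a quotient of derivatives known to be positive. This plays the part of
    common interlacing. *)
Lemma above_of_deriv s Q j y : j \notin Q ->
  (forall Q', Q \subset Q' -> admissible s Q' -> admissible s (j |: Q')) ->
  above s (j |: Q) y -> 0 < rpderivs s Q y -> above s Q y.
Proof.
move=> jQ admU ab pos Q'; move: {2}(#|Q' :\: Q|) (erefl #|Q' :\: Q|) => m.
elim: m Q' => [|m IHm] Q' Q'm QQ' adm.
  suff -> : Q' = Q by [].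
  by apply/eqP; rewrite eqEsubset QQ' andbT -setD_eq0 -cards_eq0 Q'm.
have [jQ'|jQ'] := boolP (j \in Q').
  by apply: ab => //; rewrite subUset sub1set jQ'.
have [k] : exists k, k \in Q' :\: Q.
  by apply/set0Pn; rewrite -card_gt0 Q'm.
rewrite inE => /andP[kQ kQ'].
have QE : k |: (Q' :\ k) = Q' by rewrite setD1K.
have Qk : Q \subset Q' :\ k by rewrite subsetD1 QQ'.
have adm' : admissible s (Q' :\ k) by apply: (@admissibleU1 _ _ k); rewrite QE.
have pos' : 0 < rpderivs s (Q' :\ k) y.
  apply: IHm => //; apply/eqP; rewrite -(eqn_add2l 1) [X in _ == X]add1n -Q'm.
  rewrite (cardsD1 k (Q' :\: Q)) !inE kQ kQ' /=; apply/eqP; congr (_ + _)%N.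
  by apply: eq_card => l; rewrite !inE andbCA.
have jk : j != k by apply: contraNneq jQ' => ->.
have jQ'k : j \notin Q' :\ k by rewrite !inE negb_and jQ' orbT.
have := @rpderivs_rayleigh s (Q' :\ k) y j k (admU _ Qk adm') jQ'k.
rewrite !inE eqxx /= => /(_ isT jk); rewrite QE setUCA QE => ray.
have pj : 0 < rpderivs s (j |: (Q' :\ k)) y.
  apply: ab; last exact: admU.
  by rewrite setUS.
have pjk : 0 < rpderivs s (j |: Q') y.
  by apply: ab; [rewrite setUS|exact: admU].
by rewrite -(pmulr_rgt0 _ pj); apply: lt_le_trans ray; rewrite mulr_gt0.
Qed.

Ltac fiber_lia := repeat match goal with
  | |- context [card_fiber ?Q ?k] => move: (card_fiber Q k) => ?
  | |- context [count ?p ?s] => move: (count p s) => ?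
  end; lia.

(** In every term all the copies of [i] end up deleted, so no entry of the pencils depends on their
    variables. *)
Lemma pderivs_full s Q z z' i : (card_fiber Q i + count_mem i s)%N = r ->
  (forall j, j.1 != i -> z j = z' j) -> pderivs s Q z = pderivs s Q z'.
Proof.
move=> full zz'; elim: s Q full => [|k s IHs] Q /=.
  rewrite addn0 => full; apply: eq_bigr => c _; congr (\det _).
  have iQ d : (i, d) \in Q by exact: mem_full_fiber.
  apply/matrixP => l m; rewrite !mxE; have [->|li] := eqVneq l i.
    by rewrite inE iQ.
  by rewrite zz'.
move=> full; apply: eq_bigr => c cQ; apply: IHs.
by rewrite card_fiberU1//= -addnA.
Qed.

(** * Restriction to one coordinate direction *)

Definition linept i y (t : C) : J -> C := fun j => if j.1 == i then t else (y j.1)%:C.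

(* [pderivs s Q] is affine in each variable [j], with slope [pderivs s (j |: Q)];
   substituting [t] successively for all the variables of direction [i] gives the
   polynomial [line s Q y i] in [t]. *)
Fixpoint line_rec s (L : seq J) Q z : {poly R} :=
  if L is j :: L' then
    line_rec s L' Q z + (if j \in Q then 0 else 'X * line_rec s L' (j |: Q) z)
  else (Re (pderivs s Q z))%:P.

Definition line s Q y i : {poly R} :=
  line_rec s [seq (i, c) | c <- enum 'I_r] Q (linept i y 0).

Lemma linept_real i y t : (forall j, conj (linept i y t%:C j) = linept i y t%:C j).
Proof. by move=> j; rewrite /linept; case: ifP => _; exact: conjc_real. Qed.

Lemma copies_uniq i : uniq [seq (i, c) | c <- enum 'I_r].
Proof. by rewrite map_inj_uniq ?enum_uniq// => c d []. Qed.

Lemma horner_line s Q y i t : (toC (line s Q y i)).[t] = pderivs s Q (linept i y t).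
Proof.
have recE L Q' z : uniq L -> (forall j, conj (z j) = z j) ->
    (toC (line_rec s L Q' z)).[t] = pderivs s Q' (fun j => if j \in L then z j + t else z j).
  move=> + zR; elim: L Q' => [|j L IHL] Q' /=.
    by move=> _; rewrite map_polyC hornerC /= -pderivs_real.
  move=> /andP[jL uL].
  have -> : pderivs s Q' (fun k => if k \in j :: L then z k + t else z k) =
      pderivs s Q' (upd (fun k => if k \in L then z k + t else z k) j (z j + t)).
    apply: eq_pderivs => k; rewrite /upd inE.
    by have [->|] := eqVneq k j.
  rewrite pderivs_upd (negbTE jL).
  have -> : z j + t - z j = t by rewrite addrC addKr.
  rewrite rmorphD hornerD /= IHL//; congr (_ + _).
  case: ifP => _; first by rewrite rmorph0 horner0 mulr0.
  by rewrite rmorphM /= map_polyX hornerM hornerX IHL.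
rewrite recE; last exact: linept_real.
  apply: eq_pderivs => -[k c]; rewrite /linept /=.
  have [->|ki] := eqVneq k i.
    by rewrite (map_f (pair i)) ?mem_enum// add0r.
  by case: ifP => // /mapP[d _ [/eqP]]; rewrite (negbTE ki).
exact: copies_uniq.
Qed.

Lemma horner_line_real s Q y i t : (line s Q y i).[t] = rpderivs s Q (upd y i t).
Proof.
apply: complexI; rewrite -pderivs_realpt -horner_map /= horner_line.
by apply: eq_pderivs => j; rewrite /linept /realpt /upd; case: ifP.
Qed.

Lemma deriv_line s Q y i : (line s Q y i)^`() = line (i :: s) Q y i.
Proof.
have recE L Q' z : uniq L -> (line_rec s L Q' z)^`() =
    \sum_(j <- L | j \notin Q') line_rec s L (j |: Q') z.
  elim: L Q' => [|j L IHL] Q' /=; first by rewrite derivC big_nil.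
  move=> /andP[jL uL]; rewrite derivD IHL// big_cons.
  have jU k : k \in L -> (j \in k |: Q') = (j \in Q').
    by move=> kL; rewrite !inE; case: eqP jL => // ->; rewrite kL.
  have [jQ|jQ] := boolP (j \in Q').
    rewrite derivC addr0 big_seq_cond [RHS]big_seq_cond; apply: eq_bigr => k /andP[kL _].
    by rewrite jU// jQ addr0.
  rewrite setU11 addr0 derivM derivX mul1r IHL// addrCA; congr (_ + _).
  rewrite mulr_sumr big_seq_cond [X in _ + X]big_seq_cond [RHS]big_seq_cond.
  have e k : k \in L -> (k \notin j |: Q') = (k \notin Q').
    by move=> kL; rewrite !inE; case: eqP jL => // <-; rewrite kL.
  rewrite [X in _ + X](eq_bigl (fun k => (k \in L) && (k \notin Q'))); last first.
    by move=> k; case kL: (k \in L) => //=; rewrite e.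
  rewrite -big_split; apply: eq_bigr => k /andP[kL kQ] /=.
  by rewrite jU// (negbTE jQ) setUCA.
rewrite recE ?copies_uniq//.
have consE L Q' z : line_rec (i :: s) L Q' z =
    \sum_(c | (i, c) \notin Q') line_rec s L ((i, c) |: Q') z.
  elim: L Q' => [|j L IHL] Q' /=; first by rewrite Re_sum rmorph_sum.
  rewrite IHL big_split /=; congr (_ + _).
  have [jQ|jQ] := boolP (j \in Q').
    by rewrite big1// => c _; rewrite !inE jQ orbT.
  rewrite IHL mulr_sumr big_mkcond [RHS]big_mkcond; apply: eq_bigr => c _.
  rewrite !inE (negbTE jQ) orbF negb_or [(i, c) == j]eq_sym setUCA.
  by case: (j == (i, c)); case: ((i, c) \notin Q').
by rewrite /line consE big_map big_enum_cond.
Qed.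

Lemma derivn_line s Q y i m : (line s Q y i)^`(m) = line (nseq m i ++ s) Q y i.
Proof. by elim: m => // m IHm; rewrite derivnS IHm deriv_line. Qed.

Lemma line_overfull s Q y i k : (r < card_fiber Q k + count_mem k s)%N ->
  line s Q y i = 0.
Proof.
rewrite /line; elim: [seq _ | _ <- _] Q => [|j L IHL] Q /= lt.
  by rewrite (@pderivs_overfull _ _ _ _ _ _ _ _ lt).
rewrite IHL// add0r; case: ifPn => // jQ; rewrite IHL ?mulr0//.
by rewrite card_fiberU1// addnAC; apply: leq_trans lt _; rewrite leq_addr.
Qed.

Definition degree_left s Q i : nat := (r - (card_fiber Q i + count_mem i s))%N.

(** The fixed coordinates are real, on the boundary of the half plane, where stability alone says
    nothing. Positivity at [y] starts an induction on the degree left; a nonzero derivative [h] in a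
    free copy of [i] then makes [Im (f * conj h)] positive. *)
Lemma real_rooted_line s Q y i : admissible s Q -> above s Q y ->
  real_rooted (line s Q y i).
Proof.
move=> + + t Imt; rewrite horner_line.
move: {2}(degree_left s Q i) (erefl (degree_left s Q i)) => m.
elim: m Q => [|m IHm] Q Qm adm ab.
  rewrite (@pderivs_full _ _ _ (realpt y) i).
  - by rewrite pderivs_realpt; apply/eqP => -[/eqP]; rewrite gt_eqF// ab.
  - by apply/eqP; rewrite eqn_leq adm -subn_eq0; apply/eqP.
  - by move=> j ji; rewrite /linept (negbTE ji).
have [c cQ] : exists c, (i, c) \notin Q.
  apply: exists_free_copy; rewrite ltnNge; apply/negP => ge.
  by move: Qm ge; rewrite /degree_left; fiber_lia.
have adm' : admissible s ((i, c) |: Q).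
  move=> k; rewrite card_fiberU1//=; have := adm k; move: Qm; rewrite /degree_left.
  by case: eqP => [<-|_] /=; fiber_lia.
have h_neq0 : pderivs s ((i, c) |: Q) (linept i y t) != 0.
  apply: IHm => //; last by apply: above_subset ab; exact: subsetU1.
  by move: Qm; rewrite /degree_left card_fiberU1//= eqxx; fiber_lia.
have := @pderivs_nevanlinna s Q (linept i y t) (i, c) adm' cQ.
rewrite {2}/linept /= eqxx => /(_ _)/wrap[|le].
  by move=> j; rewrite /linept; case: ifP => _ //=; rewrite ltW.
apply/eqP => f0; move: le; rewrite f0 mul0r /=; apply/negP; rewrite -ltNge mulr_gt0//.
by rewrite lt_def sqnorm_eq0 h_neq0 sqnorm_ge0.
Qed.

Lemma above_nseq m s Q y i : above s Q y -> above (nseq m i ++ s) Q y.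
Proof. by move=> ab; elim: m => //= m; exact: above_cons. Qed.

Lemma size_line s Q y i : admissible s Q -> above s Q y ->
  size (line s Q y i) = (degree_left s Q i).+1 /\ 0 < lead_coef (line s Q y i).
Proof.
move=> adm ab; set d := degree_left s Q i; set u := line s Q y i.
have ud0 k : (d < k)%N -> u`_k = 0.
  move=> dk; have : u^`(k) = 0.
    rewrite derivn_line; apply: (@line_overfull _ _ _ _ i).
    by rewrite count_cat count_nseq /= eqxx mul1n; move: dk; rewrite /d /degree_left; fiber_lia.
  move=> /(congr1 (fun p : {poly R} => p`_0)); rewrite coef_derivn coef0 addn0 => /eqP.
  by rewrite mulrn_eq0 ffactnn eqn0Ngt fact_gt0 => /eqP.
have ud : 0 < u`_d.
  have : 0 < (u^`(d)).[y i].
    rewrite derivn_line horner_line_real (_ : rpderivs _ _ _ = rpderivs (nseq d i ++ s) Q y).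
      apply: above_nseq (subxx _) _ => // k.
      rewrite count_cat count_nseq /=; have := adm k; have := adm i.
      by rewrite /d /degree_left; case: eqP => [->|_] /=; fiber_lia.
    congr Re; apply: eq_pderivs => j; rewrite /realpt /upd.
    by case: eqP => // ->.
  have -> : u^`(d) = (u`_d *+ d`!)%:P.
    apply/polyP => k; rewrite coef_derivn coefC; case: k => [|k].
      by rewrite addn0 ffactnn.
    by rewrite ud0 ?mul0rn// addnS ltnS leq_addr.
  by rewrite hornerC pmulrn_lgt0// fact_gt0.
have su : size u = d.+1.
  apply/eqP; rewrite eqn_leq; apply/andP; split.
    by apply/leq_sizeP => k; exact: ud0.
  by rewrite ltnNge; apply/negP => /leq_sizeP/(_ d (leqnn _)) ud_0; move: ud; rewrite ud_0 ltxx.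
by rewrite lead_coefE su.
Qed.

Lemma line_size_le s Q y i : (size (line s Q y i) <= (degree_left s Q i).+1)%N.
Proof.
apply/leq_sizeP => k dk; have : (line s Q y i)^`(k) = 0.
  rewrite derivn_line; apply: (@line_overfull _ _ _ _ i).
  by rewrite count_cat count_nseq /= ?eqxx ?mul1n; move: dk; rewrite /degree_left; fiber_lia.
move=> /(congr1 (fun p : {poly R} => p`_0)); rewrite coef_derivn coef0 addn0 => /eqP.
by rewrite mulrn_eq0 ffactnn eqn0Ngt fact_gt0 => /eqP.
Qed.

Hypothesis A0 : forall i, A i i = 0.

Lemma minor_diag0 S (x : 'I_n -> C) i : (forall k, k != i -> k \in S) ->
  minor A S x = if i \in S then 1 else x i.
Proof.
move=> Si; have [iS|iS] := ifPn.
  rewrite (_ : S = setT) ?minor_setT//; apply/setP => k.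
  by rewrite inE; have [->|/Si] := eqVneq k i.
have -> : minor A S x = minor A S (upd (upd x i 0) i (x i)).
  by apply: eq_minor => k; rewrite /upd; case: eqP => // ->.
have e0 : upd x i 0 i = 0 by rewrite /upd eqxx.
rewrite minor_upd (negbTE iS) e0 subr0 (_ : i |: S = setT); last first.
  by apply/setP => k; rewrite !inE; have [->|/Si] := eqVneq k i.
rewrite minor_setT mulr1 /minor (expand_det_row _ i) big1 ?add0r// => k _.
rewrite !mxE (negbTE iS) /=; have [->|ki] := eqVneq k i.
  by rewrite (negbTE iS) /upd eqxx A0 mul0rn subrr mul0r.
by rewrite Si//= mul0r.
Qed.

(** When all other coordinates are used up, the remaining minors are those of [1 x 1] blocks with
    zero diagonal: the value is a positive multiple of [y i ^+ degree_left s Q i]. *)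
Lemma rpderivs_neg_sign_free s Q y i : admissible s Q ->
  (forall k, k != i -> (card_fiber Q k + count_mem k s)%N = r) -> y i < 0 ->
  0 < (-1) ^+ degree_left s Q i * rpderivs s Q y.
Proof.
move=> + + yi; elim: s Q => [|k s IHs] Q adm full.
  have inQ k c : k != i -> (k, c) \in Q.
    by move=> ki; apply: mem_full_fiber; rewrite -[LHS]addn0; exact: full.
  have -> : degree_left [::] Q i = #|[pred c | (i, c) \notin Q]|.
    rewrite /degree_left /card_fiber addn0 -[X in (X - _)%N]card_ord.
    rewrite -(cardC [set c | (i, c) \in Q]) addKn.
    by apply: eq_card => c; rewrite !inE.
  rewrite -prodr_const /rpderivs /= /minor_prod.
  rewrite (eq_bigr (fun c => (if (i, c) \in Q then 1 else y i)%:C)); last first.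
    move=> c _; rewrite (@minor_diag0 _ _ i) ?inE; last by move=> k ki; rewrite inE inQ.
    by case: ifP.
  rewrite -rmorph_prod /= big_mkcond -big_split prodr_gt0// => c _ /=.
  by rewrite inE; case: ((i, c) \in Q) => /=; lra.
rewrite rpderivs_cons mulr_sumr.
have [c cQ] : exists c, (k, c) \notin Q.
  apply: exists_free_copy; apply: leq_trans (adm k).
  by rewrite /= eqxx addnA addn1 ltnS leq_addr.
have pos d : (k, d) \notin Q -> 0 < (-1) ^+ degree_left (k :: s) Q i * rpderivs s ((k, d) |: Q) y.
  move=> dQ; have -> : degree_left (k :: s) Q i = degree_left s ((k, d) |: Q) i.
    by rewrite /degree_left card_fiberU1//= addnA.
  apply: IHs => [|l li]; first exact: admissible_cons.
  by apply: etrans (full l li); rewrite card_fiberU1//= addnA.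
rewrite (bigD1 c)//= ltr_pwDl ?pos// sumr_ge0// => d /andP[dQ _].
by rewrite ltW// pos.
Qed.

(* The zero diagonal of [A] forces the roots in direction [i] to be nonnegative
   whenever the other coordinates are above the roots. *)
Lemma rpderivs_neg_sign s Q y t i : admissible s Q -> above s Q y -> t < 0 ->
  0 < (-1) ^+ degree_left s Q i * rpderivs s Q (upd y i t).
Proof.
move=> + + t_lt0.
have [m] := ubnP #|~: Q|; elim: m Q => // m IHm Q; rewrite ltnS => Qm adm ab.
have cardU Q' : Q \proper Q' -> (#|~: Q'| < m)%N.
  by move=> QQ'; apply: leq_trans Qm; rewrite proper_card// properC.
have properU Q' j : Q \subset Q' -> j \notin Q -> Q \proper j |: Q'.
  move=> QQ' jQ; rewrite properE (subset_trans QQ') ?subsetU1//=.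
  by apply/subsetPn; exists j => //; rewrite setU11.
have [d0|d_gt0] := posnP (degree_left s Q i).
  rewrite d0 expr0 mul1r /rpderivs (@pderivs_full _ _ _ (realpt y) i).
  - by apply: ab.
  - by apply/eqP; rewrite eqn_leq adm -subn_eq0; apply/eqP.
  - by move=> j ji; rewrite /realpt /upd (negbTE ji).
have admU j : j \notin Q -> (card_fiber Q j.1 + count_mem j.1 s < r)%N ->
    admissible s (j |: Q).
  by move=> jQ + k; rewrite card_fiberU1//; have := adm k; case: eqP => [<-|_] /=; fiber_lia.
have [c cQ] : exists c, (i, c) \notin Q.
  by apply: exists_free_copy; move: d_gt0; rewrite /degree_left; fiber_lia.
have admi : admissible s ((i, c) |: Q).
  by apply: admU => //=; move: d_gt0; rewrite /degree_left; fiber_lia.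
have [/existsP[k /andP[ki klt]]|/existsPn full] :=
    boolP [exists k, (k != i) && (card_fiber Q k + count_mem k s < r)%N]; last first.
  apply: rpderivs_neg_sign_free => // [k ki|]; last by rewrite /upd eqxx.
  by have := full k; rewrite ki /= -leqNgt => ge; apply/eqP; rewrite eqn_leq adm.
have [d dQ] : exists d, (k, d) \notin Q.
  by apply: exists_free_copy; move: klt; fiber_lia.
have ne : (i, c) != (k, d) by rewrite xpair_eqE eq_sym (negbTE ki).
have dQ' : (k, d) \notin (i, c) |: Q by rewrite inE negb_or inE eq_sym ne.
have admk : admissible s ((k, d) |: Q) by exact: admU.
have admik : admissible s ((k, d) |: ((i, c) |: Q)).
  move=> l; rewrite !card_fiberU1//=; have := adm l.
  have [<-|_] := eqVneq i l; first by rewrite (negbTE ki); move: d_gt0; rewrite /degree_left; fiber_lia.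
  by have [<-|_] := eqVneq k l; move: klt; fiber_lia.
have IH1 := IHm _ (cardU _ (properU _ _ (subxx _) cQ)) admi (above_subset (subsetU1 _ _) ab).
have IH2 := IHm _ (cardU _ (properU _ _ (subxx _) dQ)) admk (above_subset (subsetU1 _ _) ab).
have QQ : Q \subset (i, c) |: Q by exact: subsetU1.
have IH3 := IHm _ (cardU _ (properU _ _ QQ dQ)) admik
  (above_subset (subset_trans QQ (subsetU1 _ _)) ab).
(* With [d] the degree left, [f_c] and [f_ck] have sign [(-1) ^ (d - 1)] and [f_k] has sign
   [(-1) ^ d], so [f * f_ck <= f_c * f_k < 0] gives the sign of [f]. *)
have := @rpderivs_rayleigh s Q (upd y i t) (i, c) (k, d) admi cQ dQ ne.
have [ciE ckE] : degree_left s Q i = (degree_left s ((i, c) |: Q) i).+1 /\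
    degree_left s ((k, d) |: Q) i = degree_left s Q i.
  split; rewrite /degree_left card_fiberU1//= ?eqxx ?(negbTE ki) ?addn0//.
  by move: d_gt0; rewrite /degree_left; fiber_lia.
have cikE : degree_left s ((k, d) |: ((i, c) |: Q)) i = degree_left s ((i, c) |: Q) i.
  by rewrite {1}/degree_left card_fiberU1//= (negbTE ki) addn0.
move: IH1 IH2 IH3; rewrite cikE ckE ciE exprS.
rewrite -signr_odd; case: (odd _); rewrite ?expr0 ?expr1; nra.
Qed.
End Stability.

(** * The barrier argument and the choice of a colouring *)

Section Barrier.
Variables (R : rcfType) (n r : nat) (A : 'M[R[i]]_n).
Local Notation C := R[i].
Local Notation Re := (@complex.Re R).
Local Notation Im := (@complex.Im R).
Local Notation conj := (@conjc R).
Local Notation J := ('I_n * 'I_r)%type.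
Implicit Types (S : {set 'I_n}) (x y : 'I_n -> R) (Q : {set J}) (z : J -> C)
  (s : seq 'I_n) (i : 'I_n) (c : 'I_r) (j : J).
Local Notation pderivs := (@pderivs R n r A).
Local Notation rpderivs := (@rpderivs R n r A).
Local Notation above := (@above R n r A).
Local Notation line := (@line R n r A).
Hypothesis hA : hermitian A.

Lemma nevanlinna_line s Q y i j : admissible s (j |: Q) -> j \notin Q ->
  nevanlinna (line s Q y i) (line s (j |: Q) y i).
Proof.
move=> adm jQ t Imt; rewrite !(horner_line hA).
have := @pderivs_nevanlinna _ _ _ _ hA s Q (linept i y t) j adm jQ.
move=> /(_ _)/wrap[k|le]; first by rewrite /linept; case: ifP => _ //=; exact: (ltW Imt).
have : 0 <= Im (linept i y t j) * sqnorm (pderivs s (j |: Q) (linept i y t)).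
  rewrite mulr_ge0 ?sqnorm_ge0//.
  by rewrite /linept; case: ifP => _ //=; exact: (ltW Imt).
move=> /le_trans/(_ le); case: (pderivs s Q _) (pderivs s (j |: Q) _) => a b [a' b'] /=; lra.
Qed.

Lemma nevanlinna_line_cons s Q y i k : admissible (k :: s) Q ->
  nevanlinna (line s Q y i) (line (k :: s) Q y i).
Proof.
move=> adm t Imt; rewrite !(horner_line hA) /= mulr_suml Im_sum sumr_le0// => c cQ.
by rewrite -!(horner_line hA); apply: nevanlinna_line => //; exact: admissible_cons.
Qed.

Lemma horner_gt0_taylor (p : {poly R}) a t : (forall m, 0 <= p^`(m).[a]) ->
  0 < p.[a] -> a <= t -> 0 < p.[t].
Proof.
move=> pm pa at_; have -> : t = a + (t - a) by ring.
rewrite (nderiv_taylor_wide _ (leqnSn _)); last exact: mulrC.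
rewrite big_ord_recl /= nderivn0 expr0 mulr1 ltr_pwDl// sumr_ge0// => m _.
rewrite mulr_ge0 ?exprn_ge0 ?subr_ge0//.
have := pm (bump 0 m); rewrite nderivn_def hornerMn pmulrn_lge0//.
exact: fact_gt0.
Qed.

(** All the derivatives in direction [i] are nonnegative at [y], and so are the terms of the Taylor
    expansion at [y i]. *)
Lemma above_upd_ge s Q y i t : admissible s Q -> above s Q y -> y i <= t ->
  0 < rpderivs s Q (upd y i t).
Proof.
move=> adm ab yt; rewrite -horner_line_real//.
have yE : upd y i (y i) =1 y by move=> k; rewrite /upd; case: eqP => // ->.
have rE s' : rpderivs s' Q (upd y i (y i)) = rpderivs s' Q y.
  by congr Re; apply: eq_pderivs => j; rewrite /realpt yE.
apply: horner_gt0_taylor yt => [m|]; last by rewrite horner_line_real// rE ab.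
rewrite derivn_line.
have [gt|le] := ltnP r (card_fiber Q i + (m + count_mem i s)).
  rewrite (@line_overfull _ _ _ _ _ _ _ _ i) ?horner0//.
  by rewrite count_cat count_nseq /= eqxx mul1n.
rewrite horner_line_real// rE ltW//; apply: above_nseq ab _ (subxx _) _.
move=> k; rewrite count_cat count_nseq /=; have := adm k.
by case: eqP le => [->|_] /=; rewrite ?mul1n ?mul0n.
Qed.

(** Absence of zeros is assumed for the function only. Its further derivatives follow one copy at a
    time: the quotient of the derivative for [Q'] by that for [Q' :\ k] decreases in [t'] and is
    positive at [y i]. *)
Lemma above_line s Q y i t : admissible s Q -> above s Q y -> t <= y i ->
  (forall t', t <= t' -> (line s Q y i).[t'] != 0) -> above s Q (upd y i t).
Proof.
move=> adm ab ty line0.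
suff main Q' : Q \subset Q' -> admissible s Q' -> forall t', t <= t' ->
    0 < rpderivs s Q' (upd y i t').
  by move=> Q' QQ' adm'; exact: main.
have [m] := ubnP #|Q' :\: Q|; elim: m Q' => // m IHm Q'; rewrite ltnS => Q'm QQ' adm'.
have [Q'Q|/subsetPn[k kQ' kQ]] := boolP (Q' \subset Q).
  have -> : Q' = Q by apply/eqP; rewrite eqEsubset QQ' Q'Q.
  move=> t' tt'; rewrite -horner_line_real//.
  by have [_ lc] := size_line hA i adm ab; apply: (real_rooted_gt0 _ lc line0 tt');
    exact: real_rooted_line.
have Q'E : k |: (Q' :\ k) = Q' by rewrite setD1K.
have QQk : Q \subset Q' :\ k by rewrite subsetD1 QQ'.
have admk : admissible s (Q' :\ k) by apply: (@admissibleU1 _ _ _ _ k); rewrite Q'E.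
have abk := above_subset QQk ab.
have pos t' : t <= t' -> 0 < rpderivs s (Q' :\ k) (upd y i t').
  apply: IHm => //; apply: leq_trans Q'm; rewrite proper_card// properE.
  rewrite setSD ?subsetDl//=; apply/subsetPn; exists k; rewrite !inE ?kQ ?eqxx//.
have [su lu] := size_line hA i admk abk.
have kQk : k \notin Q' :\ k by rewrite !inE eqxx.
move=> t' tt'; have [yt|ty'] := leP (y i) t'.
  by apply: above_upd_ge => //; exact: above_subset ab.
have := @nevanlinna_decr _ (line s (Q' :\ k) y i) (line s Q' y i) t' (y i).
move=> /(_ (real_rooted_line hA i admk abk) lu) /(_ _)/wrap[|].
  by move=> t2 tt2; rewrite horner_line_real// gt_eqF// pos// (le_trans tt').
move=> /(_ _)/wrap[|].
  rewrite su; apply: leq_trans (line_size_le _ _ _ _ _) _; rewrite ltnS /degree_left leq_sub2l//.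
  rewrite leq_add2r subset_leq_card//; apply/subsetP => c; rewrite !inE => /andP[_ ->//].
move=> /(_ _)/wrap[|]; first by rewrite -{2}Q'E; apply: nevanlinna_line => //; rewrite Q'E.
move=> /(_ (ltW ty')); rewrite !horner_line_real//.
have yE Q2 : rpderivs s Q2 (upd y i (y i)) = rpderivs s Q2 y.
  by congr Re; apply: eq_pderivs => j; rewrite /realpt /upd; case: eqP => // ->.
rewrite !yE => le; have p1 : 0 < rpderivs s (Q' :\ k) y by apply: abk.
rewrite -(pmulr_lgt0 _ p1); apply: lt_le_trans le.
by rewrite mulr_gt0 ?pos//; apply: ab.
Qed.

Lemma line_upd s Q y i t : line s Q (upd y i t) i = line s Q y i.
Proof.
rewrite /line; elim: [seq _ | _ <- _] Q => [|j L IHL] Q /=.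
  congr (Re _)%:P; apply: eq_pderivs => j; rewrite /linept.
  by rewrite /upd; case: (j.1 == i).
by rewrite !IHL.
Qed.

Hypothesis A0 : forall i, A i i = 0.

(** For a polynomial of degree [m > 0], [- u_(m-1) / u_m] is the sum of the zeros. On coefficients,
    the bound passes at once to the derivative, whose zeros have the same mean. *)
Definition mean_root_le s y i (mu : R) :=
  let m := degree_left s (set0 : {set J}) i in
  - (line s set0 y i)`_m.-1 <= m%:R * mu * (line s set0 y i)`_m.

(* When [m] is the degree left in direction [i], the zeros in that direction are
   nonnegative and sum to at most [m * mu], and [y i = mu * (2 * m + 4)]. Deriving
   and moving down by [2 * mu] keeps the zeros below and the barrier functions
   [rpderivs (k :: s) set0 y / rpderivs s set0 y] under control, because
   [2 * mu] times the logarithmic derivative at the new point is at most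
   [(m ^ 2 + 3 * m) / ((m + 1) * (m + 2)) < 1]. *)
Lemma barrier_step s y i mu (m := degree_left s (set0 : {set J}) i)
    (y' := upd y i (mu * (2 * m%:R + 2))) :
  admissible (i :: s) (set0 : {set J}) -> above s set0 y -> 0 < mu ->
  y i = mu * (2 * m%:R + 4) -> mean_root_le s y i mu ->
  [/\ above (i :: s) set0 y', mean_root_le (i :: s) y' i mu &
   forall k, admissible (k :: s) (set0 : {set J}) ->
     rpderivs (k :: i :: s) set0 y' * rpderivs s set0 y <=
     rpderivs (k :: s) set0 y * rpderivs (i :: s) set0 y'].
Proof.
move=> admi ab mu_gt0 yi mean; have adm := admissible_behead admi.
set u := line s set0 y i in mean; have rru := real_rooted_line hA i adm ab.
have [su lu] := size_line hA i adm ab.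
have m_gt0 : (0 < m)%N.
  by have := admi i; rewrite /m /degree_left /= eqxx subn_gt0 addnA addn1 addSn addnC.
have uneg t : t < 0 -> u.[t] != 0.
  move=> t_lt0; rewrite horner_line_real//.
  have := rpderivs_neg_sign hA A0 i adm ab t_lt0.
  by apply: contraTneq => ->; rewrite mulr0 ltxx.
have [u0 shift] := bound_from_mean_root rru lu su m_gt0 mu_gt0 uneg mean.
have m0 : 0 < m%:R :> R by rewrite ltr0n.
set x := mu * (2 * m%:R + 2) in y' shift *.
have xu t : x <= t -> u.[t] != 0.
  move=> xt; apply: u0; apply: lt_le_trans xt; rewrite /x; nra.
have xy : x <= y i by rewrite yi /x; nra.
have ab' : above s set0 y' by exact: above_line.
split; first exact: above_cons.
  rewrite /mean_root_le line_upd -deriv_line//.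
  have -> : degree_left (i :: s) (set0 : {set J}) i = m.-1.
    by rewrite /m /degree_left /= eqxx addnCA add1n subnS.
  have um : 0 < u`_m by rewrite -[m]/(m.+1.-1) -su -lead_coefE.
  move: mean um; rewrite /mean_root_le -/m -/u !coef_deriv.
  (* For [m = 1] the derivative is constant and the claim only says that it is nonnegative. *)
  case: (m) m_gt0 => // -[|p] _ /=; first by rewrite !mul0r mulr1n oppr_le0 => _ /ltW.
  move=> mean _; rewrite -[X in - X]mulr_natl -[X in _ <= _ * X]mulr_natl -mulrN -mulrA ler_wpM2l//.
  by apply: le_trans mean _; rewrite mulrCA mulrA.
move=> k admk.
(* The barrier in direction [k] is the quotient of [line (k :: s)] by [line s] as functions of the
   variable of [i]; it is compared at [x] after derivation and at [y i = x + 2 * mu] before. *)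
have := @nevanlinna_deriv_shift _ u (line (k :: s) set0 y i) x (y i) rru lu xu.
rewrite su => /(_ _)/wrap[|].
  apply: leq_trans (line_size_le _ _ _ _ _) _; rewrite ltnS /degree_left leq_sub2l//.
  by rewrite leq_add2l /= leq_addl.
move=> /(_ (nevanlinna_line_cons _ _ admk) xy) /(_ _)/wrap[|].
  by rewrite yi; have -> : mu * (2 * m%:R + 4) - x = 2 * mu by rewrite /x; ring.
rewrite !deriv_line// !horner_line_real//.
have yE s2 : rpderivs s2 set0 (upd y i (y i)) = rpderivs s2 set0 y.
  by congr Re; apply: eq_pderivs => j; rewrite /realpt /upd; case: eqP => // ->.
rewrite !yE [X in X * _ <= _](_ : _ = rpderivs (k :: i :: s) set0 y')//.
congr Re; apply: pderivs_perm; exact: permEl (perm_catCA [:: i] [:: k] s).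
Qed.

Lemma degree_left_set0 s i : degree_left s (set0 : {set J}) i = (r - count_mem i s)%N.
Proof.
by rewrite /degree_left /card_fiber (eq_card (B := pred0)) ?card0// => c; rewrite !inE.
Qed.

Lemma admissible_set0 s :
  admissible s (set0 : {set J}) <-> forall i, (count_mem i s <= r)%N.
Proof.
split=> adm i; have := adm i; rewrite /card_fiber (eq_card (B := pred0)) ?card0// => c;
  by rewrite !inE.
Qed.

(** Each derivation lowers the degree left by one, hence the height [mu * (2 * degree + 4)] by
    [2 * mu]. The inequalities between successive ratios chain up, so the bound [phi] survives in
    the directions not yet visited. *)
Lemma barrier_nseq s y i mu phi m :
  admissible s (set0 : {set J}) -> count_mem i s = 0%N -> above s set0 y ->
  0 < mu -> y i = mu * (2 * r%:R + 4) -> mean_root_le s y i mu ->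
  (forall k, k != i -> count_mem k s = 0%N ->
    rpderivs (k :: s) set0 y <= phi * rpderivs s set0 y) ->
  (m < r)%N ->
  let y' := upd y i (mu * (2 * (r - m)%:R + 4)) in
  [/\ above (nseq m i ++ s) set0 y', mean_root_le (nseq m i ++ s) y' i mu &
   forall k, k != i -> count_mem k s = 0%N ->
     rpderivs (k :: nseq m i ++ s) set0 y' <= phi * rpderivs (nseq m i ++ s) set0 y'].
Proof.
move=> adm si ab mu_gt0 yi mean phiP; elim: m => [|m IHm] mr /=.
  by rewrite subn0 -yi (_ : upd y i (y i) = y)//; apply: boolp.funext => k;
     rewrite /upd; case: eqP => // ->.
have [abm meanm phim] := IHm (ltnW mr).
set ym := upd y i _ in abm meanm phim.
have cE k : count_mem k (nseq m i ++ s) = ((i == k) * m + count_mem k s)%N.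
  by rewrite count_cat count_nseq.
have cm : degree_left (nseq m i ++ s) (set0 : {set J}) i = (r - m)%N.
  by rewrite degree_left_set0 cE eqxx mul1n si addn0.
have admm : admissible (i :: nseq m i ++ s) (set0 : {set J}).
  apply/admissible_set0 => k /=; rewrite cE; have [<-|_] := eqVneq i k.
    by rewrite si addn0 mul1n add1n ltnW.
  by rewrite mul0n !add0n; have /admissible_set0/(_ k) := adm.
have [] := @barrier_step (nseq m i ++ s) ym i mu admm abm mu_gt0 _ meanm.
  by rewrite cm /ym /upd eqxx.
rewrite cm (_ : upd ym i _ = upd y i (mu * (2 * (r - m.+1)%:R + 4))); last first.
  apply: boolp.funext => k; rewrite /ym /upd; case: eqP => // _.
  rewrite -[(r - m)%N](@prednK _) ?subn_gt0 1?ltnW// -subnS -addn1 natrD; ring.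
move=> ab' mean' phi'; split=> // k ki sk.
have p1 : 0 < rpderivs (nseq m i ++ s) set0 ym.
  exact: abm (subxx _) (admissible_behead admm).
rewrite -(ler_pM2r p1); apply: le_trans (phi' k _) _.
  apply/admissible_set0 => l /=; rewrite cE; have [<-|_] := eqVneq k l.
    by rewrite sk addn0 eq_sym (negbTE ki) mul0n addn0 (leq_ltn_trans _ mr).
  rewrite add0n -cE; have /admissible_set0/(_ l) := admm.
  by apply: leq_trans; rewrite /= leq_addl.
rewrite mulrAC ler_wpM2r ?phim// ltW//.
exact: (ab' _ (subxx _) admm).
Qed.

Definition repeat_all (l : seq 'I_n) := flatten [seq nseq r.-1 i | i <- l].

Lemma count_repeat_all l k : uniq l -> count_mem k (repeat_all l) = ((k \in l) * r.-1)%N.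
Proof.
elim: l => //= i l IHl /andP[il ul].
rewrite /repeat_all /= count_cat -/(repeat_all l) IHl// count_nseq in_cons /=.
by have [->|ki] := eqVneq k i; rewrite ?(negbTE il) /= ?mul1n ?mul0n ?addn0 ?add0n.
Qed.

(** A direction outside [l] is still at [a] with barrier at most [r * mu]. This bounds the mean of
    its zeros, and [r - 1] derivations bring it down to [mu * (2 * 1 + 4)]. *)
Lemma barrier_all a (l : seq 'I_n) : (1 < r)%N -> uniq l -> 1 < a ->
  a ^+ 2 = 2 * r%:R + 5 ->
  let mu := a / (a ^+ 2 - 1) in
  above [::] set0 (fun=> a) ->
  (forall k, rpderivs [:: k] set0 (fun=> a) <= r%:R * mu * rpderivs [::] set0 (fun=> a)) ->
  let y k := if k \in l then 6 * mu else a in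
  above (repeat_all l) set0 y /\
  forall k, k \notin l ->
    rpderivs (k :: repeat_all l) set0 y <= r%:R * mu * rpderivs (repeat_all l) set0 y.
Proof.
move=> r_gt1 + a1 a2 mu ab0 phi0; have r_gt0 := ltnW r_gt1; elim: l => [|i l IHl] /=.
  by move=> _; split.
move=> /andP[il ul]; have [ab phi] := IHl ul.
set y := fun k => _ in ab phi.
have mu_gt0 : 0 < mu by rewrite /mu divr_gt0//; nra.
have aE : a = mu * (2 * r%:R + 4).
  by rewrite /mu (_ : 2 * r%:R + 4 = a ^+ 2 - 1) ?divfK// ?a2 ?gt_eqF//; [nra|lra].
have yi : y i = a by rewrite /y (negbTE il).
have adm : admissible (repeat_all l) (set0 : {set J}).
  apply/admissible_set0 => k; rewrite count_repeat_all//.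
  by case: (k \in l); rewrite ?mul1n ?mul0n// leq_pred.
have si : count_mem i (repeat_all l) = 0%N by rewrite count_repeat_all// (negbTE il).
have cr : degree_left (repeat_all l) (set0 : {set J}) i = r by rewrite degree_left_set0 si subn0.
have rru := real_rooted_line hA i adm ab.
have [su lu] := size_line hA i adm ab; rewrite cr in su.
have yE s : rpderivs s set0 (upd y i a) = rpderivs s set0 y.
  by congr Re; apply: eq_pderivs => j; rewrite /realpt /upd; case: eqP => // ->; rewrite yi.
have mean : mean_root_le (repeat_all l) y i mu.
  rewrite /mean_root_le cr; apply: (mean_root_from_bound rru lu su r_gt0 a1).
  - move=> t at_; rewrite horner_line_real// gt_eqF//.
    by apply: above_upd_ge => //; rewrite yi.
  - move=> t t0; have := rpderivs_neg_sign hA A0 i adm ab t0.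
    by rewrite horner_line_real//; apply: contraTneq => ->; rewrite mulr0 ltxx.
  - by rewrite deriv_line// !horner_line_real// !yE phi.
have r1 : (r.-1 == 0)%N = false by move: r_gt1; case: (r) => [|[]].
have [|k _ /eqP||ab' _ phi'] := @barrier_nseq _ y i mu (r%:R * mu) r.-1 adm si ab mu_gt0 _ mean.
- by rewrite yi.
- rewrite count_repeat_all// muln_eq0 eqb0 r1 orbF; exact: phi.
- by rewrite prednK.
have y'E : upd y i (mu * (2 * (r - r.-1)%:R + 4)) = (fun k => if k \in i :: l then 6 * mu else a).
  apply: boolp.funext => k; rewrite /upd inE; case: eqP => //= _.
  have -> : (r - r.-1 = 1)%N by case: (r) r_gt0 => // p _; rewrite subSnn.
  by ring.
rewrite y'E in ab' phi'; split=> // k; rewrite inE negb_or => /andP[ki kl].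
by apply: phi' => //; rewrite count_repeat_all// (negbTE kl).
Qed.

(** A positive sum has a positive term, given by the derivation in [m] particular copies of [i]. *)
Lemma rpderivs_nseq_gt0 m s Q y i : 0 < rpderivs (nseq m i ++ s) Q y ->
  exists Q', [/\ Q \subset Q', forall k c, k != i -> ((k, c) \in Q') = ((k, c) \in Q),
    card_fiber Q' i = (card_fiber Q i + m)%N & 0 < rpderivs s Q' y].
Proof.
elim: m Q => [|m IHm] Q pos; first by exists Q; rewrite addn0.
have [c cQ posc] : exists2 c, (i, c) \notin Q & 0 < rpderivs (nseq m i ++ s) ((i, c) |: Q) y.
  apply/exists_inP; apply: contraTT pos => /exists_inPn neg.
  by rewrite -leNgt /= rpderivs_cons; apply: sumr_le0 => c /neg; rewrite -leNgt.
have [Q' [QQ' Q'E cQ' pos']] := IHm _ posc; exists Q'; split=> //.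
- exact: subset_trans (subsetU1 _ _) QQ'.
- by move=> k d ki; rewrite Q'E// !inE xpair_eqE (negbTE ki).
- by rewrite cQ' card_fiberU1//= eqxx addn1 addSnnS.
Qed.

(** Whichever copy of [i] is left, deriving in it too gives the same function, derived in all the
    copies of [i]: the common interlacer. The sum over the choices is positive at [y], so one of
    them is, and [above_of_deriv] strengthens this to being above the zeros. *)
Lemma choose_copies (l : seq 'I_n) Q y : (0 < r)%N -> uniq l ->
  (forall i, i \in l -> card_fiber Q i = 0%N) ->
  (forall i, i \notin l -> card_fiber Q i = r.-1) ->
  above (repeat_all l) Q y ->
  exists Q', above [::] Q' y /\ forall i, card_fiber Q' i = r.-1.
Proof.
move=> r_gt0; elim: l Q => [|i l IHl] Q /=.
  by move=> _ _ Qr ab; exists Q; split=> // i; exact: Qr.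
move=> /andP[il ul] Q0 Qr ab; rewrite /repeat_all /= -/(repeat_all l) in ab.
set s := repeat_all l in ab *.
have si : count_mem i s = 0%N by rewrite count_repeat_all// (negbTE il).
have sle k : (count_mem k s <= r.-1)%N.
  by rewrite count_repeat_all//; case: (k \in l); rewrite ?mul1n.
have adm : admissible (nseq r.-1 i ++ s) Q.
  move=> k; rewrite count_cat count_nseq /= count_repeat_all//.
  have [<-|ik] := eqVneq i k; first by rewrite Q0 ?mem_head// (negbTE il) addn0 mul1n leq_pred.
  have [kl|kl] := boolP (k \in l); first by rewrite Q0 ?inE ?kl ?orbT// mul1n leq_pred.
  by rewrite Qr ?addn0 ?leq_pred// inE negb_or eq_sym ik.
have [Q1 [QQ1 Q1E cQ1 pos1]] := rpderivs_nseq_gt0 (ab _ (subxx _) adm).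
have cQ1r : card_fiber Q1 i = r.-1 by rewrite cQ1 Q0 ?mem_head.
have Q1k k : k != i -> card_fiber Q1 k = card_fiber Q k.
  by move=> ki; apply: eq_card => c; rewrite !inE Q1E.
apply: (IHl Q1) => // [k kl|k kl|].
- rewrite Q1k ?Q0 ?inE ?kl ?orbT//; by apply: contraNneq il => <-.
- have [->//|ki] := eqVneq k i; rewrite Q1k// Qr//.
  by rewrite inE negb_or ki.
have [c cQ] : exists c, (i, c) \notin Q1.
  by apply: exists_free_copy; rewrite cQ1r prednK.
apply: (@above_of_deriv _ _ _ _ hA _ _ (i, c)) => //.
  move=> Q' QQ' adm' k; have [<-|ik] := eqVneq i k; first by rewrite si addn0 card_fiber_le.
  apply: leq_trans (adm' k); rewrite leq_add2r subset_leq_card//; apply/subsetP => d.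
  by rewrite !inE xpair_eqE eq_sym (negbTE ik).
have cfull : card_fiber ((i, c) |: Q1) i = r.
  by rewrite card_fiberU1// cQ1r eqxx addn1 prednK.
(* To recover the term of [Q2] from the sum, only the copy [c] of [i] is kept in [Q3]; the [r - 1]
   derivations in direction [i] must then use up all the other copies. *)
move=> Q2 QQ2 adm2; pose Q3 := Q2 :\: [set j | (j.1 == i) && (j.2 != c)].
have icQ2 : (i, c) \in Q2 by apply: (subsetP QQ2); rewrite setU11.
have Q3k k d : k != i -> ((k, d) \in Q3) = ((k, d) \in Q2).
  by move=> ki; rewrite !inE /= (negbTE ki).
have cQ3 : card_fiber Q3 i = 1%N.
  rewrite /card_fiber (_ : [set d | _] = [set c]) ?cards1//; apply/setP => d.
  rewrite !inE /= eqxx /= negbK.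
  by have [->|] := eqVneq d c.
have adm3 : admissible (nseq r.-1 i ++ s) Q3.
  move=> k; rewrite count_cat count_nseq /=.
  have [<-|ik] := eqVneq i k; first by rewrite cQ3 si addn0 mul1n add1n prednK.
  rewrite mul0n add0n; apply: leq_trans (adm2 k); rewrite leq_add2r subset_leq_card//.
  by apply/subsetP => d; rewrite !inE => /andP[].
have QQ3 : Q \subset Q3.
  apply/subsetP => -[k d] kQ; rewrite !inE /= (subsetP QQ2) ?andbT; last first.
    by rewrite in_setU1 (subsetP QQ1)// orbT.
  have [ki|//] := eqVneq k i; have := Q0 i (mem_head _ _).
  by move=> /eqP; rewrite cards_eq0 => /eqP/setP/(_ d); rewrite !inE -ki kQ.
have [Q4 [QQ4 Q4E cQ4 pos4]] := rpderivs_nseq_gt0 (ab _ QQ3 adm3).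
suff -> : Q2 = Q4 by [].
apply/setP => -[k d]; have [->|ki] := eqVneq k i; last by rewrite Q4E// Q3k.
rewrite [RHS]mem_full_fiber ?cQ4 ?cQ3 ?add1n ?prednK//.
by apply: (subsetP QQ2); rewrite mem_full_fiber.
Qed.

(** Positivity is obtained for every [S] containing the complement of a colour class because this is
    what makes the form of [6 * mu - A] nonnegative on the class. *)
Lemma minor_partition a : (1 < r)%N -> 1 < a -> a ^+ 2 = 2 * r%:R + 5 ->
  let mu := a / (a ^+ 2 - 1) in
  (forall S, 0 < minor A S (fun=> a%:C)) ->
  (forall k, minor A [set k] (fun=> a%:C) <= mu%:C * minor A set0 (fun=> a%:C)) ->
  exists chi : 'I_n -> 'I_r, forall c S, (forall i, chi i != c -> i \in S) ->
    0 < Re (minor A S (fun=> (6 * mu)%:C)).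
Proof.
move=> r_gt1 a1 a2 mu pos phi; have r_gt0 := ltnW r_gt1.
have ab0 : above [::] set0 (fun=> a).
  move=> Q _ _; rewrite /rpderivs /= /minor_prod.
  have : 0 < \prod_c minor A (slice Q c) (fun=> a%:C) by apply: prodr_gt0.
  by rewrite ltcE => /andP[_].
(* There is one term for each of the [r] copies of [k], and in it only the factor of one colour
   changes, by a ratio at most [mu]. *)
have phi0 k : rpderivs [:: k] set0 (fun=> a) <= r%:R * mu * rpderivs [::] set0 (fun=> a).
  rewrite rpderivs_cons; apply: (@le_trans _ _ (\sum_(c < r) mu * rpderivs [::] set0 (fun=> a))).
    rewrite (eq_bigl predT); last by move=> c; rewrite inE.
    apply: ler_sum => c _; rewrite /rpderivs /= /minor_prod.
    rewrite (bigD1 c)//= [X in _ <= mu * Re X](bigD1 c)//=.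
    have slice0 d : slice (set0 : {set J}) d = set0 by apply/setP => l; rewrite !inE.
    have -> : slice ((k, c) |: (set0 : {set J})) c = [set k].
      by apply/setP => l; rewrite !inE xpair_eqE eqxx andbT orbF.
    rewrite (eq_bigr (fun=> minor A set0 (fun=> a%:C))); last first.
      move=> d dc; congr minor; apply/setP => l.
      by rewrite !inE xpair_eqE (negbTE dc) andbF.
    rewrite [X in _ <= mu * Re (_ * X)](eq_bigr (fun=> minor A set0 (fun=> a%:C))); last first.
      by move=> d dc; rewrite slice0.
    rewrite slice0; set p := \prod_(_ | _) _.
    have p_gt0 : 0 < p by apply: prodr_gt0.
    have : minor A [set k] (fun=> a%:C) * p <= mu%:C * minor A set0 (fun=> a%:C) * p.
      by rewrite ler_pM2r.
    rewrite lecE -mulrA => /andP[_].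
    rewrite [X in _ <= X -> _](_ : _ = mu * Re (minor A set0 (fun=> a%:C) * p))//.
    by case: (_ * p) => ? ? /=; rewrite mul0r subr0.
  by rewrite sumr_const card_ord -[leLHS]mulr_natl mulrA.
have [ab _] := barrier_all r_gt1 (enum_uniq 'I_n) a1 a2 ab0 phi0.
have yE : (fun k => if k \in enum 'I_n then 6 * (a / (a ^+ 2 - 1)) else a) = (fun=> 6 * mu).
  by apply: boolp.funext => k; rewrite mem_enum.
rewrite yE in ab.
have card0 i : card_fiber (set0 : {set J}) i = 0%N.
  by rewrite /card_fiber (eq_card (B := pred0)) ?card0// => c; rewrite !inE.
have [||Q [abQ cQ]] := choose_copies r_gt0 (enum_uniq 'I_n) _ _ ab.
- by move=> i _.
- by move=> i; rewrite mem_enum.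
(* Exactly one copy of [i] is outside [Q], and it gives the colour of [i]; the default is never
   reached. *)
exists (fun i => odflt (Ordinal r_gt0) [pick c | (i, c) \notin Q]) => c S chiS.
(* Deriving in all the copies of the other colours reduces their minors to [1] and isolates that of
   [c]. *)
pose Q' : {set J} := [set j | (j.2 != c) || (j.1 \in S)].
have QQ' : Q \subset Q'.
  apply/subsetP => -[i d] iQ; rewrite inE /=; have [dc|//] := eqVneq d c.
  apply: chiS; case: pickP => [e eQ|allQ] /=.
    by apply: contraNneq eQ => ->; rewrite -dc.
  have [e eQ] : exists e, (i, e) \notin Q by apply: exists_free_copy; rewrite cQ prednK.
  by have := allQ e; rewrite eQ.
have := abQ Q' QQ' _; rewrite /rpderivs /= /minor_prod (bigD1 c)//= big1 ?mulr1; last first.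
  move=> d dc; rewrite (_ : slice Q' d = setT) ?minor_setT//.
  by apply/setP => i; rewrite !inE dc.
rewrite (_ : slice Q' c = S); last by apply/setP => i; rewrite !inE eqxx.
by apply=> k; rewrite addn0 card_fiber_le.
Qed.
End Barrier.

(** * Quadratic forms *)

Section RealDot.
Variables (R : rcfType) (n : nat).
Local Notation C := R[i].
Local Notation Re := (@complex.Re R).
Local Notation Im := (@complex.Im R).
Local Notation conj := (@conjc R).
Implicit Types (u v w : 'rV[C]_n) (A : 'M[C]_n) (S : {set 'I_n}).

(** The real part of the hermitian product is a symmetric bilinear form over [R]; hermitian forms
    being real, it determines them. *)
Definition rdot u v : R := \sum_k Re (u 0 k * conj (v 0 k)).

Lemma rdotC u v : rdot u v = rdot v u.
Proof.
by apply: eq_bigr => k _; case: (u 0 k) (v 0 k) => a b [a' b'] /=; ring.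
Qed.

Lemma rdotDl u v w : rdot (u + v) w = rdot u w + rdot v w.
Proof.
rewrite -big_split; apply: eq_bigr => k _ /=; rewrite mxE.
by case: (u 0 k) (v 0 k) (w 0 k) => a b [a' b'] [a2 b2] /=; ring.
Qed.

Lemma rdotZl (c : R) u v : rdot (c%:C *: u) v = c * rdot u v.
Proof.
rewrite mulr_sumr; apply: eq_bigr => k _ /=; rewrite mxE.
by case: (u 0 k) (v 0 k) => a b [a' b'] /=; ring.
Qed.

Lemma rdotDr u v w : rdot w (u + v) = rdot w u + rdot w v.
Proof. by rewrite rdotC rdotDl ![rdot _ w]rdotC. Qed.

Lemma rdotZr (c : R) u v : rdot u (c%:C *: v) = c * rdot u v.
Proof. by rewrite rdotC rdotZl rdotC. Qed.

Lemma rdot0r u : rdot u 0 = 0.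
Proof. by have := rdotZr 0 u 0; rewrite rmorph0 scale0r mul0r. Qed.

Lemma rdotNl u v : rdot (- u) v = - rdot u v.
Proof. by have := rdotZl (-1) u v; rewrite rmorphN1 scaleN1r mulN1r. Qed.

Lemma rdotNr u v : rdot u (- v) = - rdot u v.
Proof. by rewrite rdotC rdotNl rdotC. Qed.

Lemma rdot_sqnorm u : rdot u u = \sum_k sqnorm (u 0 k).
Proof. by apply: eq_bigr => k _; rewrite mul_conj. Qed.

Lemma rdot_ge0 u : 0 <= rdot u u.
Proof. by rewrite rdot_sqnorm sumr_ge0// => k _; exact: sqnorm_ge0. Qed.

Lemma rdot_eq0 u : (rdot u u == 0) = (u == 0).
Proof.
apply/eqP/eqP => [|->]; last first.
  by apply: big1 => k _; rewrite mxE mul0r.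
rewrite rdot_sqnorm => /eqP; rewrite psumr_eq0 => [/allP u0|k _]; last exact: sqnorm_ge0.
apply/rowP => k; rewrite mxE; apply/eqP; rewrite -sqnorm_eq0.
exact: u0 (mem_index_enum _).
Qed.

Lemma sqnormM (c d : C) : sqnorm (c * d) = sqnorm c * sqnorm d.
Proof. by case: c d => a b [a' b']; rewrite /sqnorm /=; ring. Qed.

Lemma rdot_scale (c : C) u : rdot (c *: u) (c *: u) = sqnorm c * rdot u u.
Proof. by rewrite !rdot_sqnorm mulr_sumr; apply: eq_bigr => k _; rewrite mxE sqnormM. Qed.

Definition adjoint A : 'M[C]_n := \matrix_(i, k) conj (A k i).

Lemma rdot_adjoint A u v : rdot (u *m A) v = rdot u (v *m adjoint A).
Proof.
rewrite /rdot; under eq_bigr do rewrite mxE mulr_suml Re_sum.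
rewrite exchange_big; apply: eq_bigr => i _ /=; rewrite -Re_sum; congr Re.
rewrite mxE rmorph_sum mulr_sumr; apply: eq_bigr => k _.
by rewrite mxE rmorphM /= conjcK; ring.
Qed.

Lemma hermitian_adjoint A : hermitian A -> adjoint A = A.
Proof. by move=> hA; apply/matrixP => i k; rewrite mxE. Qed.

Lemma rdot_hermitian A u v : hermitian A -> rdot (u *m A) v = rdot u (v *m A).
Proof. by move=> hA; rewrite rdot_adjoint hermitian_adjoint. Qed.

Lemma rdot_form_delta A k : hermitian A -> A k k = 0 ->
  rdot (delta_mx 0 k *m A) (delta_mx 0 k) = 0.
Proof.
move=> hA Ak; apply: big1 => i _; rewrite -rowE !mxE.
have [->|ik] := eqVneq i k; first by rewrite Ak mul0r.
by rewrite andbF mulr0n rmorph0 mulr0.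
Qed.
End RealDot.

(** * Principal minors and quadratic form of a hermitian contraction *)

Section Positivity.
Variables (R : rcfType) (n : nat) (A : 'M[R[i]]_n).
Local Notation C := R[i].
Local Notation Re := (@complex.Re R).
Local Notation Im := (@complex.Im R).
Local Notation conj := (@conjc R).
Implicit Types (u v w : 'rV[C]_n) (S : {set 'I_n}).
Hypothesis hA : hermitian A.
Hypothesis cA : forall v, rdot (v *m A) (v *m A) <= rdot v v.

Lemma ltr0c (x : R) : (0 < x%:C) = (0 < x).
Proof. by rewrite ltcE /= eqxx. Qed.

Lemma hermitian_scale (c : R) : hermitian (c%:C *: A).
Proof. by move=> i k; rewrite !mxE rmorphM /= hA; congr (_ * _); exact: conjc_real. Qed.

(** A kernel vector [v] vanishes on [S] and satisfies [x * v = t * (v *m A)] off [S], so that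
    contraction gives [x ^ 2 * |v|^2 <= t ^ 2 * |v|^2]. *)
Lemma scaled_minor_neq0 (t x : R) S : 0 <= t -> t < x ->
  minor (t%:C *: A) S (fun=> x%:C) != 0.
Proof.
move=> t_ge0 tx; apply/det0P => -[v v_neq0 /pencil_kerP[vS vN]].
move/negP: v_neq0; apply; rewrite -rdot_eq0.
have : x ^+ 2 * rdot v v <= t ^+ 2 * rdot v v.
  apply: (@le_trans _ _ (t ^+ 2 * rdot (v *m A) (v *m A))); last first.
    by rewrite ler_wpM2l ?sqr_ge0.
  rewrite !rdot_sqnorm !mulr_sumr; apply: ler_sum => k _.
  have [kS|kS] := boolP (k \in S).
    by rewrite vS// /sqnorm /= expr0n /= addr0 mulr0 mulr_ge0 ?sqr_ge0// addr_ge0 ?sqr_ge0.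
  have sE (c : R) (d : C) : c ^+ 2 * sqnorm d = sqnorm (d * c%:C).
    by rewrite sqnormM mulrC /sqnorm /= expr0n addr0.
  rewrite !sE vN// -scalemxAr mxE mulrC.
  by rewrite mulrC.
move=> le; have v0 := rdot_ge0 v; apply/eqP/le_anti; rewrite v0 andbT.
rewrite leNgt; apply/negP => v_gt0; move: le; rewrite ler_pM2r//; nra.
Qed.

(** Deform [A] linearly to [0] and [a] to [1]: since [t < x t] on the way, the minor never vanishes,
    and at [t = 0] it is [1]. *)
Lemma minor_gt0 (a : R) S : 1 < a -> 0 < minor A S (fun=> a%:C).
Proof.
move=> a1; pose x t := 1 - t + t * a.
pose F t := minor (t%:C *: A) S (fun=> (x t)%:C).
have FR t : F t = (Re (F t))%:C.
  have := minor_conj S (fun=> (x t)%:C) (hermitian_scale t).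
  rewrite (@eq_minor _ _ _ _ _ (fun=> (x t)%:C)); last by move=> ?; exact: conjc_real.
  rewrite -/(F t).
  by case: (F t) => ? b [] /eqP; rewrite eq_sym -addr_eq0 -mulr2n mulrn_eq0 => /eqP ->.
have [p [q FE]] : polyfun F.
  apply: polyfun_det => i k.
  apply: (eq_polyfun (f := fun t => if (i \in S) || (k \in S) then (i == k)%:R
      else (x t)%:C *+ (i == k) - t%:C * A i k)); first by move=> t; rewrite !mxE.
  case: ((i \in S) || (k \in S)); first exact: polyfun_cst.
  have xP : polyfun (fun t => (x t)%:C).
    apply: (eq_polyfun (f := fun t => 1 - t%:C + t%:C * a%:C)).
      by move=> t; rewrite /x rmorphD rmorphB rmorphM rmorph1.
    apply: polyfunD; last by apply: polyfunM; [exact: polyfun_id|exact: polyfun_cst].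
    by apply: polyfunD; [exact: polyfun_cst|apply: polyfunN; exact: polyfun_id].
  apply: polyfunD.
    by case: (i == k); [exact: xP|exact: polyfun_cst].
  by apply: polyfunN; apply: polyfunM; [exact: polyfun_id|exact: polyfun_cst].
have pF t : (p.[t])%:C = F t by rewrite FR FE.
have F0 : F 0 = 1.
  rewrite /F /x rmorph0 scale0r subr0 mul0r addr0 /minor -(det1 C n); congr (\det _).
  by apply/matrixP => i k; rewrite !mxE subr0; case: ifP.
have p0 : p.[0] = 1 by apply: complexI; rewrite pF F0.
have -> : minor A S (fun=> a%:C) = F 1.
  by rewrite /F /x subrr add0r mul1r rmorph1 scale1r.
rewrite -pF ltr0c ltNge; apply/negP => p1.
have p01 : (- p).[0] <= 0 <= (- p).[1].
  by rewrite !hornerN p0 oppr_ge0 p1 oppr_le0 ler01.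
have [t] := poly_ivt ler01 p01; rewrite rootN => /andP[t0 t1] /rootP pt.
have tx : t < x t.
  have : 0 <= t * (a - 1) by rewrite mulr_ge0 ?subr_ge0// ltW.
  by rewrite /x; have [t_lt1|t_ge1] := ltP t 1; nra.
by have := scaled_minor_neq0 S t0 tx; rewrite -/(F t) -pF pt rmorph0 eqxx.
Qed.

(* The [k]-th row of the adjugate solves [w *m pencil S x = minor S x *: e_k]. *)
Lemma adj_row S x k (w := row k (\adj (pencil A S x))) : k \notin S ->
  [/\ w 0 k = minor A (k |: S) x, forall j, j \in S -> w 0 j = 0 &
   forall j, j \notin S -> w 0 j * x j - (w *m A) 0 j = minor A S x *+ (j == k)].
Proof.
move=> kS; have wM : w *m pencil A S x = minor A S x *: delta_mx 0 k.
  by rewrite -row_mul mul_adj_mx rowE mul_mx_scalar.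
have wk : w 0 k = minor A (k |: S) x.
  rewrite !mxE /minor (expand_det_row _ k) (bigD1 k)//= big1 ?addr0 => [|l lk]; last first.
    by rewrite mxE setU11 eq_sym (negbTE lk) mul0r.
  rewrite mxE setU11 eqxx mul1r /cofactor; congr (_ * \det _); apply/matrixP => l m.
  by rewrite !mxE !inE ![lift _ _ == k]eq_sym !(negbTE (neq_lift _ _)).
move: (w) wk wM => {}w wk wM; have wME j := mulmx_pencil A S x w j.
have wS j : j \in S -> w 0 j = 0.
  move=> jS; have := wME j; rewrite wM !mxE jS => <-.
  have /negbTE -> : j != k by apply: contraNneq kS => <-.
  by rewrite andbF mulr0.
split=> // j jS; have := wME j; rewrite wM (negbTE jS) -mulmx_supported// => <-.
by rewrite !mxE eqxx /= mulr_natr.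
Qed.

Definition gap (b : R) v := b%:C *: v - v *m A.

Lemma gapZ b (c : C) v : gap b (c *: v) = c *: gap b v.
Proof. by rewrite /gap -scalemxAl scalerBr !scalerA mulrC. Qed.

Lemma rdot_gapC b u v : rdot (gap b u) v = rdot u (gap b v).
Proof.
by rewrite /gap !(rdotDl, rdotDr, rdotNl, rdotNr, rdotZl, rdotZr) rdot_hermitian.
Qed.

(* Schur complement: [w] is orthogonal, for the form [gap b], to the vectors
   supported off [k |: S]. *)
Lemma rdot_gap_ge0 b S v : (forall S', S \subset S' -> 0 < Re (minor A S' (fun=> b%:C))) ->
  (forall k, k \in S -> v 0 k = 0) -> 0 <= rdot (gap b v) v.
Proof.
have [m] := ubnP #|~: S|; elim: m S v => // m IHm S v; rewrite ltnS => Sm pos vS.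
have [ST|/subsetPn[k _ kS]] := boolP (setT \subset S).
  have -> : v = 0 by apply/rowP => k; rewrite mxE vS// (subsetP ST).
  by rewrite rdot0r.
have minorR S' : minor A S' (fun=> b%:C) = (Re (minor A S' (fun=> b%:C)))%:C.
  have := minor_conj S' (fun=> b%:C) hA.
  rewrite (@eq_minor _ _ _ _ _ (fun=> b%:C)); last by move=> ?; exact: conjc_real.
  by case: (minor _ _ _) => ? b' [] /eqP; rewrite eq_sym -addr_eq0 -mulr2n mulrn_eq0 => /eqP ->.
have [] := adj_row (fun=> b%:C) kS.
move: (row k _) => w wk wS; set d := minor A S _ => wE.
have pk : 0 < Re (minor A (k |: S) (fun=> b%:C)) by apply: pos; exact: subsetU1.
have pS : 0 < Re d by exact: pos.
have wk0 : w 0 k != 0 by rewrite wk minorR; apply/eqP => -[p0]; rewrite p0 ltxx in pk.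
(* Subtracting [c *: w] kills the coordinate [k]. The form splits into that of [u], supported off
   [k |: S], and [sqnorm c] times the product of two positive minors. *)
pose c := v 0 k / w 0 k; have [u uE] : {u | u = v - c *: w} by exists (v - c *: w).
have uk : u 0 k = 0 by rewrite uE !mxE /c divfK// subrr.
have uS j : j \in k |: S -> u 0 j = 0.
  by rewrite in_setU1 => /predU1P[->//|jS]; rewrite uE !mxE vS// wS// mulr0 subrr.
have cwdot (t : 'rV[C]_n) : (forall j, j \in S -> t 0 j = 0) ->
    rdot (gap b (c *: w)) t = Re (c * d * conj (t 0 k)).
  move=> tS; rewrite /rdot (bigD1 k)//= big1 ?addr0 => [|j jk].
    have := wE k kS; rewrite eqxx mulr1n => dE.
    by rewrite gapZ mxE (_ : gap b w 0 k = d)// -dE !mxE mulrC.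
  have [jS|jS] := boolP (j \in S); first by rewrite tS// rmorph0 mulr0.
  rewrite gapZ mxE (_ : gap b w 0 j = 0) ?mulr0 ?mul0r//.
  by have := wE j jS; rewrite (negbTE jk) mulr0n => <-; rewrite !mxE mulrC.
have vE : v = u + c *: w by rewrite uE subrK.
have cwS j : j \in S -> (c *: w) 0 j = 0 by move=> jS; rewrite mxE wS// mulr0.
have gD : gap b v = gap b u + gap b (c *: w).
  by rewrite vE /gap mulmxDl scalerDr opprD addrACA.
rewrite {2}vE gD rdotDl !rdotDr [rdot (gap b u) (c *: w)]rdot_gapC [rdot u _]rdotC.
have uS' j : j \in S -> u 0 j = 0 by move=> jS; rewrite uS// in_setU1 jS orbT.
rewrite !cwdot// uk rmorph0 mulr0 addr0 add0r addr_ge0//.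
  apply: (IHm (k |: S)) => // [|S' kS']; last by apply: pos; exact: subset_trans (subsetU1 _ _) kS'.
  apply: leq_trans Sm; rewrite proper_card// properC properE subsetU1.
  by apply/subsetPn; exists k; rewrite ?setU11.
rewrite mxE wk minorR /d minorR -/d.
have -> : forall (e : C) (p q : R), Re (e * p%:C * conj (e * q%:C)) = sqnorm e * p * q.
  by move=> [e1 e2] p q; rewrite /sqnorm /=; ring.
by rewrite !mulr_ge0 ?sqnorm_ge0 ?(ltW pS) ?(ltW pk).
Qed.

Hypothesis A0 : forall i, A i i = 0.

(* [1 / (a - x) <= (a + x) / (a ^ 2 - 1)] for [-1 <= x <= 1], applied to the diagonal
   entries of [1 / (a - A)], those of [A] being zero. *)
Lemma minor1_le (a : R) k : 1 < a ->
  minor A [set k] (fun=> a%:C) <= (a / (a ^+ 2 - 1))%:C * minor A set0 (fun=> a%:C).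
Proof.
move=> a1; have pk := minor_gt0 [set k] a1; have p0 := minor_gt0 set0 a1.
have [] := @adj_row set0 (fun=> a%:C) k; first by rewrite inE.
move: (row k _) => w; rewrite setU0 => wk _ wE.
have RE S : 0 < minor A S (fun=> a%:C) ->
    minor A S (fun=> a%:C) = (Re (minor A S (fun=> a%:C)))%:C.
  by rewrite ltcE => /andP[/eqP]; case: (minor _ _ _) => ? ? /= ->.
have Pk := RE _ pk; have P0 := RE _ p0; move: pk p0; rewrite Pk P0.
set al := Re (minor A [set k] _) in Pk *; set D := Re (minor A set0 _) in P0 *.
rewrite !ltr0c -rmorphM lecR => al_gt0 D_gt0.
have gw : gap a w = D%:C *: delta_mx 0 k.
  apply/rowP => j; have := wE j; rewrite inE P0 => /(_ isT) dE.
  rewrite [RHS]mxE [delta_mx _ _ _ _]mxE eqxx mulr_natr -dE.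
  by rewrite /gap 3!mxE [a%:C * _]mulrC.
(* [w] is [D] times the row [k] of [1 / (a - A)]; the four numbers are its moments for [1], [A],
   [A ^ 2] and [A ^ 3]. *)
pose p := rdot w w; pose q := rdot (w *m A) w.
pose s := rdot (w *m A) (w *m A); pose t := rdot (w *m A *m A) (w *m A).
have e1 : D * al = a * p - q.
  have : rdot (gap a w) w = D * al.
    rewrite gw rdotZl; congr (_ * _); rewrite /rdot (bigD1 k)//= big1 ?addr0 => [|j jk].
      by rewrite mxE !eqxx mul1r wk Pk.
    by rewrite mxE (negbTE jk) andbF mul0r.
  by rewrite /gap rdotDl rdotNl rdotZl.
(* The form of [a + A] at [gap a w], which is [D] times a basis vector, equals [a * D ^ 2] by the
   zero diagonal; it is expanded through [(a + A) * (a - A) ^ 2]. *)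
have e2 : a * D ^+ 2 = a ^+ 3 * p - a ^+ 2 * q - a * s + t.
  have yy : rdot (gap a w) (gap a w) = D ^+ 2.
    rewrite gw rdotZl rdotZr mulrA -expr2 /rdot (bigD1 k)//= big1 ?addr0 => [|j jk].
      by rewrite mxE !eqxx mul1r rmorph1 mulr1.
    by rewrite mxE (negbTE jk) andbF mul0r.
  have yAy : rdot (gap a w *m A) (gap a w) = 0.
    by rewrite gw -scalemxAl rdotZl rdotZr rdot_form_delta// !mulr0.
  have sq : rdot (w *m A *m A) w = s by rewrite rdot_hermitian.
  rewrite -yy -[LHS]addr0 -yAy /gap !(mulmxBl, =^~ scalemxAl).
  rewrite !(rdotDl, rdotDr, rdotNl, rdotNr, rdotZl, rdotZr).
  rewrite -/p -/q -/s -/t sq [rdot w (w *m A)]rdotC -/q.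
  ring.
have ps : s <= p by exact: cA.
have form_le u : - rdot u u <= rdot (u *m A) u.
  have := rdot_ge0 (u + u *m A); rewrite !(rdotDl, rdotDr) [rdot u (u *m A)]rdotC.
  have := cA u; lra.
(* This is the nonnegativity of [(1 + A) * (1 - A) ^ 2] at [w]. *)
have := form_le (w - w *m A).
rewrite mulmxBl !(rdotDl, rdotDr, rdotNl, rdotNr).
have sq : rdot (w *m A *m A) w = s by rewrite rdot_hermitian.
rewrite -/p -/q -/s -/t sq [rdot w (w *m A)]rdotC -/q => wAw.
have a21 : 0 < a ^+ 2 - 1 by nra.
rewrite mulrAC ler_pdivlMr// -(ler_pM2l D_gt0).
have : a * D ^+ 2 - (a ^+ 2 - 1) * (D * al) = a * (p - s) + t - q.
  by rewrite e2 e1; ring.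
have : p - s <= a * (p - s) by rewrite ler_peMl ?subr_ge0// ltW.
by nra.
Qed.

Theorem hermitian_upper_paving r a : (1 < r)%N -> 1 < a -> a ^+ 2 = 2 * r%:R + 5 ->
  exists chi : 'I_n -> 'I_r, forall c v, (forall i, chi i != c -> v 0 i = 0) ->
    rdot (v *m A) v <= 6 * (a / (a ^+ 2 - 1)) * rdot v v.
Proof.
move=> r_gt1 a1 a2.
have [chi chiP] := minor_partition hA A0 r_gt1 a1 a2
  (fun S => minor_gt0 S a1) (fun k => minor1_le k a1).
exists chi => c v vc.
have := @rdot_gap_ge0 (6 * (a / (a ^+ 2 - 1))) [set i | chi i != c] v.
rewrite /gap rdotDl rdotNl rdotZl subr_ge0; apply=> [S sub|i].
  by apply: (chiP c) => i ic; apply: (subsetP sub); rewrite inE.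
by rewrite inE; exact: vc.
Qed.
End Positivity.

(** * Paving of matrices *)

Section MatrixPaving.
Variables (R : rcfType) (n r : nat) (a : R).
Local Notation C := R[i].
Local Notation Re := (@complex.Re R).
Local Notation Im := (@complex.Im R).
Local Notation conj := (@conjc R).
Implicit Types (u v w : 'rV[C]_n) (A T : 'M[C]_n).
Hypotheses (r_gt1 : (1 < r)%N) (a_gt1 : 1 < a) (a2 : a ^+ 2 = 2 * r%:R + 5).
Local Notation bound := (6 * (a / (a ^+ 2 - 1))).

Definition bounded_by (tau : R) T := forall v, rdot (v *m T) (v *m T) <= tau ^+ 2 * rdot v v.

Lemma bounded_byZ (c : C) tau T : bounded_by tau T ->
  forall v, rdot (v *m (c *: T)) (v *m (c *: T)) <= sqnorm c * tau ^+ 2 * rdot v v.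
Proof. by move=> bT v; rewrite -scalemxAr rdot_scale -mulrA ler_wpM2l ?sqnorm_ge0. Qed.

Lemma sqnorm_real (c : R) : sqnorm c%:C = c ^+ 2.
Proof. by rewrite /sqnorm /= expr0n addr0. Qed.

Lemma hermitian_paving A tau : hermitian A -> (forall i, A i i = 0) -> 0 < tau ->
  bounded_by tau A ->
  exists chi : 'I_n -> 'I_r * 'I_r, forall c v, (forall i, chi i != c -> v 0 i = 0) ->
    `|rdot (v *m A) v| <= bound * tau * rdot v v.
Proof.
move=> hA A0 tau_gt0 bA.
have hZ (e : R) : hermitian (e%:C *: A) by exact: hermitian_scale.
have A0Z (e : R) i : (e%:C *: A) i i = 0 by rewrite mxE A0 mulr0.
have bZ (e : R) : e ^+ 2 = tau ^- 2 -> forall v,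
    rdot (v *m (e%:C *: A)) (v *m (e%:C *: A)) <= rdot v v.
  move=> eE v; apply: le_trans (bounded_byZ _ bA v) _.
  by rewrite sqnorm_real eE mulVf ?mul1r// expf_neq0// gt_eqF.
have [chi1 P1] := hermitian_upper_paving (hZ tau^-1) (bZ _ (exprVn _ _)) (A0Z _)
  r_gt1 a_gt1 a2.
have eN : (- tau^-1) ^+ 2 = tau ^- 2 by rewrite sqrrN exprVn.
have [chi2 P2] := hermitian_upper_paving (hZ (- tau^-1)) (bZ _ eN) (A0Z _) r_gt1 a_gt1 a2.
exists (fun i => (chi1 i, chi2 i)) => -[c1 c2] v vc.
have := P1 c1 v _; have := P2 c2 v _.
rewrite -!scalemxAr !rdotZl => /(_ _)/wrap[|le2].
  by move=> i ic; apply: vc; rewrite xpair_eqE negb_and ic orbT.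
move=> /(_ _)/wrap[|le1].
  by move=> i ic; apply: vc; rewrite xpair_eqE negb_and ic.
move: le1 le2; rewrite mulNr !(mulrC tau^-1) -!mulNr !ler_pdivrMr//.
by move=> le1 le2; rewrite ler_norml (mulrAC bound) le1 andbT lerNl.
Qed.

(** Polarisation: the form is compared at [gamma * v + w] and [gamma * v - w], where [w] is the part
    of [v *m A] supported in [P]. *)
Lemma restricted_bound A gamma (P : pred 'I_n) : hermitian A -> 0 < gamma ->
  (forall v, (forall i, ~~ P i -> v 0 i = 0) -> `|rdot (v *m A) v| <= gamma * rdot v v) ->
  forall v, (forall i, ~~ P i -> v 0 i = 0) ->
    \sum_(k | P k) sqnorm ((v *m A) 0 k) <= gamma ^+ 2 * rdot v v.
Proof.
move=> hA g_gt0 form v vP.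
pose w : 'rV[C]_n := \row_k if P k then (v *m A) 0 k else 0.
have wP i : ~~ P i -> w 0 i = 0 by move=> /negbTE iP; rewrite mxE iP.
have ww : \sum_(k | P k) sqnorm ((v *m A) 0 k) = rdot w w.
  rewrite rdot_sqnorm [RHS](bigID P) /= [X in _ = _ + X]big1 ?addr0.
    by apply: eq_bigr => k Pk; rewrite [w 0 k]mxE Pk.
  by move=> k /wP ->; rewrite /sqnorm /= expr0n addr0.
have vw : rdot (v *m A) w = rdot w w.
  apply: eq_bigr => k _; have [Pk|/wP ->] := boolP (P k); first by rewrite [w 0 k]mxE Pk.
  by rewrite rmorph0 !mulr0.
have wv : rdot (w *m A) v = rdot w w by rewrite rdot_hermitian// rdotC.
rewrite ww; have lin (e : R) i : ~~ P i -> (gamma%:C *: v + e%:C *: w) 0 i = 0.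
  by move=> iP; rewrite 3!mxE vP// wP// !mulr0 addr0.
have := form _ (lin 1); have := form _ (lin (-1)).
rewrite !mulmxDl -!scalemxAl !(rdotDl, rdotDr, rdotZl, rdotZr).
rewrite wv vw [rdot w v]rdotC.
rewrite !ler_norml => /andP[le1 _] /andP[_ le2].
have : gamma * (2 * rdot w w) <= gamma * (gamma ^+ 2 * rdot v v + rdot w w) by nra.
by rewrite ler_pM2l//; lra.
Qed.

Lemma rdotD_le u v : rdot (u + v) (u + v) <= 2 * (rdot u u + rdot v v).
Proof.
have := rdot_ge0 (u - v).
by rewrite !(rdotDl, rdotDr, rdotNl, rdotNr); lra.
Qed.

(** Expand [|w *m T - tau ^ 2 * v|^2 >= 0] for [w = v *m adjoint T] and use the bound on
    [w *m T]. *)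
Lemma bounded_by_adjoint tau T : 0 < tau -> bounded_by tau T -> bounded_by tau (adjoint T).
Proof.
move=> tau_gt0 bT v; set w := v *m adjoint T.
have e1 : rdot w w = rdot (w *m T) v by rewrite rdot_adjoint.
have := rdot_ge0 (w *m T - (tau ^+ 2)%:C *: v).
rewrite !(rdotDl, rdotDr, rdotNl, rdotNr, rdotZl, rdotZr) [rdot v (w *m T)]rdotC -e1.
have := bT w => le ge.
have : tau ^+ 2 * rdot w w <= tau ^+ 2 * (tau ^+ 2 * rdot v v) by nra.
by rewrite ler_pM2l// exprn_gt0.
Qed.

Theorem matrix_paving T tau : 0 <= tau -> (forall i, T i i = 0) -> bounded_by tau T ->
  exists chi : 'I_n -> 'I_r * 'I_r * ('I_r * 'I_r),
    forall c v, (forall i, chi i != c -> v 0 i = 0) ->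
    \sum_(k | chi k == c) sqnorm ((v *m T) 0 k) <= (2 * bound * tau) ^+ 2 * rdot v v.
Proof.
(* A zero bound cannot be normalised to [1]; in that case every [v *m T] is zero and a constant
   colouring will do. *)
move=> + T0 bT; rewrite le_eqVlt => /predU1P[tau0|tau_gt0].
  have c0 := Ordinal (ltnW r_gt1); exists (fun=> ((c0, c0), (c0, c0))) => c v _.
  rewrite -tau0 mulr0 expr0n mul0r big1// => k _.
  have /eqP : rdot (v *m T) (v *m T) = 0.
    by apply: le_anti; rewrite rdot_ge0 andbT (le_trans (bT v))// -tau0 expr0n mul0r.
  by rewrite rdot_eq0 => /eqP ->; rewrite mxE /sqnorm /= expr0n addr0.
have bT' := bounded_by_adjoint tau_gt0 bT.
have half e f : sqnorm e = 4^-1 -> sqnorm f = 4^-1 -> bounded_by tau (e *: T + f *: adjoint T).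
  move=> e2 f2 v; rewrite mulmxDr; apply: le_trans (rdotD_le _ _) _.
  have := bounded_byZ e bT v; have := bounded_byZ f bT' v; rewrite e2 f2; lra.
have Tadj i k : adjoint T i k = conj (T k i) by rewrite mxE.
pose h : C := (2^-1)%:C; pose g : C := 0 +i* (- 2^-1).
have h4 : sqnorm h = 4^-1 by rewrite /sqnorm /=; field.
have g4 : sqnorm g = 4^-1 by rewrite /sqnorm /=; field.
have gN4 : sqnorm (- g) = 4^-1 by rewrite /sqnorm /=; field.
(* [A = (T + adjoint T) / 2] and [B = (T - adjoint T) / (2 * 'i)]; coefficients of square modulus
   [1 / 4] keep the bound [tau]. *)
pose A := h *: T + h *: adjoint T; pose B := g *: T + (- g) *: adjoint T.
have hA : hermitian A.
  move=> i k; rewrite !mxE; case: (T i k) (T k i) => x y [x' y'].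
  by apply/eqP; rewrite eq_complex /=; apply/andP; split; apply/eqP; ring.
have hB : hermitian B.
  move=> i k; rewrite !mxE; case: (T i k) (T k i) => x y [x' y'].
  by apply/eqP; rewrite eq_complex /=; apply/andP; split; apply/eqP; ring.
have A0 i : A i i = 0 by rewrite !mxE T0 rmorph0 !mulr0 addr0.
have B0 i : B i i = 0 by rewrite !mxE T0 rmorph0 !mulr0 addr0.
have [chiA PA] := hermitian_paving hA A0 tau_gt0 (half _ _ h4 h4).
have [chiB PB] := hermitian_paving hB B0 tau_gt0 (half _ _ g4 gN4).
have TE : T = A + 'i *: B.
  apply/matrixP => i k; rewrite !mxE; case: (T i k) (T k i) => x y [x' y'].
  by apply/eqP; rewrite eq_complex /=; apply/andP; split; apply/eqP; field.
clearbody A B; exists (fun i => (chiA i, chiB i)) => -[cA cB] v vc.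
have b_gt0 : 0 < bound * tau.
  have : 0 < a / (a ^+ 2 - 1) by rewrite divr_gt0 ?subr_gt0 ?exprn_egt1// (lt_trans ltr01).
  by move=> b0; rewrite mulr_gt0// mulr_gt0.
pose P i := (chiA i, chiB i) == (cA, cB).
have vP i : ~~ P i -> v 0 i = 0 by exact: vc.
have leA : \sum_(k | P k) sqnorm ((v *m A) 0 k) <= (bound * tau) ^+ 2 * rdot v v.
  apply: restricted_bound => // w wP; apply: (PA cA) => i ic; apply: wP.
  by rewrite /P xpair_eqE negb_and ic.
have leB : \sum_(k | P k) sqnorm ((v *m B) 0 k) <= (bound * tau) ^+ 2 * rdot v v.
  apply: restricted_bound => // w wP; apply: (PB cB) => i ic; apply: wP.
  by rewrite /P xpair_eqE negb_and ic orbT.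
(* The inequality [|p + 'i * q|^2 <= 2 * (|p|^2 + |q|^2)] is the origin of the factor [2] in the
   final constant. *)
apply: (@le_trans _ _ (\sum_(k | P k) 2 * (sqnorm ((v *m A) 0 k) + sqnorm ((v *m B) 0 k)))).
  apply: ler_sum => k _; rewrite TE mulmxDr -scalemxAr.
  move: (v *m A) (v *m B) => p q; rewrite !mxE.
  case: (p 0 k) (q 0 k) => x y [x' y']; rewrite /sqnorm /=.
  by have := sqr_ge0 (x + y'); have := sqr_ge0 (y - x'); lra.
rewrite -mulr_sumr big_split /=.
have -> : 2 * bound * tau = 2 * (bound * tau) by rewrite -mulrA.
rewrite exprMn; lra.
Qed.
End MatrixPaving.

From mathcomp Require Import all_classical all_reals all_analysis.
Import numFieldNormedType.Exports.
Local Open Scope classical_set_scope.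
Local Open Scope ring_scope.
Local Open Scope complex_scope.

(** * From finite sections to operators *)

Section Compactness.
Variables (K : finType) (f : nat -> nat -> K).

Definition prefix_cluster m (g : nat -> K) :=
  forall M, exists N, (M <= N)%N /\ forall k, (k < m)%N -> g k = f N k.

(** Pigeonhole: if each colour [x] failed beyond some [M x], take [N] beyond all of them such that
    [f N] starts like [g]; the colour [f N m] does not fail there. *)
Lemma prefix_cluster_extend m g : prefix_cluster m g ->
  exists x, prefix_cluster m.+1 (upd g m x).
Proof.
move=> gm; apply: contrapT => /forallNP noext.
have Mx x : exists M, forall N, (M <= N)%N ->
    ~ forall k, (k < m.+1)%N -> upd g m x k = f N k.
  have /existsNP[M /forallNP MN] := noext x.
  by exists M => N MleN agree; apply: (MN N).
pose M x := projT1 (cid (Mx x)).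
have [N [MN agree]] := gm (\max_x M x).
have := projT2 (cid (Mx (f N m))); apply; first exact: leq_trans (leq_bigmax _) MN.
move=> k; rewrite ltnS leq_eqVlt /upd; case: eqP => [->//|_] /=; exact: agree.
Qed.

Lemma exists_cluster_coloring : K ->
  exists chi : nat -> K, forall m, exists N, (m <= N)%N /\ forall k, (k < m)%N -> chi k = f N k.
Proof.
move=> x0.
pose ext m g := xget x0 [set x | prefix_cluster m.+1 (upd g m x)].
pose F := fix F m := if m is m'.+1 then upd (F m') m' (ext m' (F m')) else fun=> x0.
have Fcl m : prefix_cluster m (F m).
  elim: m => [|m /prefix_cluster_extend[x xP]] /=; first by move=> M; exists M.
  exact: (@xgetPex _ x0 [set z | prefix_cluster m.+1 (upd (F m) m z)] (ex_intro _ x xP)).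
have Fstable m k d : (k < m)%N -> F (m + d)%N k = F m k.
  move=> km; elim: d => [|d IHd]; first by rewrite addn0.
  by rewrite addnS /= /upd ltn_eqF ?IHd// ltn_addr.
(* Stage [m] fixes only the values below [m], so the value at [k] is read at stage [k + 1]. *)
exists (fun k => F k.+1 k) => m; have [N [mN agree]] := Fcl m m.
exists N; split=> // k km; rewrite -agree//.
by rewrite -(subnKC km) Fstable.
Qed.
End Compactness.

(** * Norms, operators and truncations on square-summable sequences *)

Section SequenceSpace.
Variable R : realType.
Local Notation C := R[i].
Local Notation ell2 := (ell2 R).
Implicit Types (x y : ell2) (v : nat -> C).

Lemma sqmodE v n : sqmod v n = sqnorm (v n).
Proof. by rewrite /sqmod /sqnorm; case: (v n) => a b /=; rewrite sqr_sqrtr ?addr_ge0 ?sqr_ge0. Qed.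

Definition sqnorm2 x : R := limn (series (sqmod x)).

Lemma ell2_cvg x : cvgn (series (sqmod x)).
Proof. exact/square_summableP/ell2_summable. Qed.

Lemma nondecreasing_series_sqmod v : nondecreasing_seq (series (sqmod v)).
Proof. by apply: nondecreasing_series => n _ _; rewrite sqmodE sqnorm_ge0. Qed.

Lemma series_le_sqnorm2 x n : series (sqmod x) n <= sqnorm2 x.
Proof. by apply: nondecreasing_cvgn_le; [exact: nondecreasing_series_sqmod|exact: ell2_cvg]. Qed.

Lemma sqnorm2_le x b : (forall n, series (sqmod x) n <= b) -> sqnorm2 x <= b.
Proof. by move=> xb; apply: limr_le; [exact: ell2_cvg|exact: nearW]. Qed.

Lemma sqnorm2_ge0 x : 0 <= sqnorm2 x.
Proof. by apply: le_trans (series_le_sqnorm2 x 0); rewrite /series /= big_geq. Qed.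

Lemma l2norm_ge0 x : 0 <= l2norm x. Proof. exact: sqrtr_ge0. Qed.

Lemma sqr_l2norm x : l2norm x ^+ 2 = sqnorm2 x.
Proof. by rewrite sqr_sqrtr// sqnorm2_ge0. Qed.

Lemma l2norm_le x b : 0 <= b -> (l2norm x <= b) = (sqnorm2 x <= b ^+ 2).
Proof. by move=> b0; rewrite -sqr_l2norm ler_sqr ?nnegrE ?l2norm_ge0. Qed.

Lemma ell2_val_inj x y : (forall n, x n = y n) -> x = y.
Proof. by move=> xy; apply: val_inj; apply/funext. Qed.

Lemma ell2D x y n : (x + y) n = x n + y n. Proof. by []. Qed.
Lemma ell2N x n : (- x) n = - x n. Proof. by []. Qed.

Lemma ell2_sum (I : Type) (l : seq I) (P : pred I) (F : I -> ell2) n :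
  (\sum_(i <- l | P i) F i) n = \sum_(i <- l | P i) F i n.
Proof. by elim/big_rec2 : _ => // i a b _ <-. Qed.

Lemma sqnorm2Z (c : C) x : sqnorm2 (c *: x) = sqnorm c * sqnorm2 x.
Proof.
rewrite /sqnorm2 (_ : series (sqmod (c *: x)) = (fun n => sqnorm c * series (sqmod x) n)).
  by apply/cvg_lim => //; apply: cvgMr; exact: ell2_cvg.
apply/funext => n; rewrite /series /= mulr_sumr; apply: eq_bigr => k _.
by rewrite !sqmodE sqnormM.
Qed.

Lemma inner_ebasis x k : inner x (ebasis R k) = x k.
Proof.
rewrite /inner; apply: (@lim_near_cst (R[i]^o) (@norm_hausdorff _ _) nat).
near=> n; have kn : (k < n)%N by near: n; exact: nbhs_infty_gt.
rewrite /series /= big_mkord (bigD1 (Ordinal kn))//= eqxx big1 ?addr0.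
  by rewrite rmorph1 mulr1.
move=> i /negPf; rewrite -val_eqE /= => ->.
by rewrite rmorph0 mulr0.
Unshelve. all: by end_near. Qed.

Section BoundedOp.
Variable T : bounded_op R.

Lemma opnorm_has_sup : has_sup [set l2norm (T x) | x in [set x : ell2 | l2norm x <= 1]].
Proof.
split.
  exists (l2norm (T 0)), 0 => //=; rewrite l2norm_le ?ler01// expr1n.
  apply: sqnorm2_le => n; rewrite /series /= big1 ?ler01// => k _.
  by rewrite sqmodE /sqnorm /= expr0n addr0.
have [M MP] := bounded_opP T; exists (Num.max 0 M) => _ [x x1 <-].
apply: le_trans (MP x) _; apply: (@le_trans _ _ (Num.max 0 M * l2norm x)).
  by rewrite ler_wpM2r ?l2norm_ge0// le_max lexx orbT.
by rewrite ler_piMr// le_max lexx.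
Qed.

Lemma opnorm_ge0 : 0 <= opnorm T.
Proof.
have [[_ [x x1 _]] ubT] := opnorm_has_sup.
by apply: le_trans (l2norm_ge0 (T x)) _; apply: ub_le_sup => //; exists x.
Qed.

Lemma l2norm_op_le x : l2norm (T x) <= opnorm T * l2norm x.
Proof.
(* A vector of zero norm cannot be normalised; boundedness gives directly that its image has zero
   norm. *)
have [x0|x0] := eqVneq (l2norm x) 0.
  by have [M /(_ x)] := bounded_opP T; rewrite x0 !mulr0.
have x_gt0 : 0 < l2norm x by rewrite lt_def x0 l2norm_ge0.
have scale (c : R) y : 0 <= c -> l2norm (c%:C *: y) = c * l2norm y.
  move=> c0; rewrite /l2norm -/(sqnorm2 _) sqnorm2Z sqrtrM ?sqnorm_ge0//.
  by rewrite sqnorm_real sqrtr_sqr ger0_norm.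
rewrite -ler_pdivrMr// mulrC -scale ?invr_ge0 ?l2norm_ge0// -linearZ.
apply: ub_le_sup; first by have [] := opnorm_has_sup.
by exists ((l2norm x)^-1%:C *: x) => //=; rewrite scale ?invr_ge0 ?l2norm_ge0// mulVf.
Qed.

Lemma sqnorm2_op_le x : sqnorm2 (T x) <= opnorm T ^+ 2 * sqnorm2 x.
Proof.
rewrite -!sqr_l2norm -exprMn ler_sqr ?nnegrE ?mulr_ge0 ?opnorm_ge0 ?l2norm_ge0//.
exact: l2norm_op_le.
Qed.
End BoundedOp.

Definition truncation N v : ell2 := \sum_(0 <= k < N) v k *: ebasis R k.

Lemma truncationE N v n : truncation N v n = if (n < N)%N then v n else 0.
Proof.
rewrite ell2_sum; elim: N => [|N IHN]; first by rewrite big_geq.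
rewrite big_nat_recr//= IHN [X in _ + X](_ : _ = v N * (n == N)%:R)// ltnS [(n <= N)%N]leq_eqVlt /=.
have [->|] := eqVneq n N; first by rewrite ltnn mulr1 add0r.
by rewrite mulr0 addr0.
Qed.

Lemma sqnorm2_truncation N v : sqnorm2 (truncation N v) = \sum_(0 <= k < N) sqnorm (v k).
Proof.
apply: le_anti; apply/andP; split.
  apply: sqnorm2_le => n; rewrite /series /=.
  have -> : \sum_(0 <= k < n) sqmod (truncation N v) k =
      \sum_(0 <= k < n | (k < N)%N) sqnorm (v k).
    rewrite [RHS]big_mkcond; apply: eq_bigr => k _; rewrite sqmodE truncationE.
    by case: ifP => // _; rewrite /sqnorm /= expr0n addr0.
  have [nN|Nn] := leqP n N.
    rewrite (big_cat_nat _ nN)//= big_nat_cond [X in _ <= X + _]big_nat_cond.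
    rewrite (eq_bigl (fun k => (0 <= k < n)%N && true)); last first.
      move=> k /=; case kn: (k < n)%N => //=; exact: leq_trans nN.
    by rewrite lerDl sumr_ge0// => k _; exact: sqnorm_ge0.
  rewrite (big_cat_nat _ (ltnW Nn))//= [X in _ + X]big_nat_cond [X in _ + X]big1 ?addr0.
    rewrite big_nat_cond [leRHS]big_nat_cond (eq_bigl (fun k => (0 <= k < N)%N && true))//.
    by move=> k /=; case: (k < N)%N.
  by move=> k /andP[/andP[Nk _]]; rewrite ltnNge Nk.
apply: le_trans (series_le_sqnorm2 _ N); rewrite /series /= big_nat_cond [leRHS]big_nat_cond.
by apply: ler_sum => k /andP[/andP[_ kN] _]; rewrite sqmodE truncationE kN.
Qed.

Lemma op_truncation (T : bounded_op R) N v n :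
  T (truncation N v) n = \sum_(0 <= k < N) v k * T (ebasis R k) n.
Proof. by rewrite linear_sum ell2_sum; apply: eq_bigr => k _; rewrite linearZ. Qed.

End SequenceSpace.

(** * Diagonal projectors attached to sets of indices *)

Section CoordinateProjector.
Variables (R : realType) (P : pred nat).
Local Notation ell2 := (ell2 R).
Implicit Types x y : ell2.

Definition mask_seq (x : nat -> R[i]) : nat -> R[i] := fun n => if P n then x n else 0.

Lemma series_mask_le x n : series (sqmod (mask_seq x)) n <= series (sqmod x) n.
Proof.
apply: ler_sum => k _; rewrite !sqmodE /mask_seq; case: ifP => // _.
by rewrite /sqnorm /= expr0n addr0 addr_ge0 ?sqr_ge0.
Qed.

Lemma mask_summable x : mask_seq x \in @square_summable R.
Proof.
apply/square_summableP; apply: nondecreasing_is_cvgn.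
  exact: nondecreasing_series_sqmod.
exists (sqnorm2 x) => _ [n _ <-].
exact: le_trans (series_mask_le x n) (series_le_sqnorm2 x n).
Qed.

Definition mask x : ell2 := Ell2 (mask_summable x).

Lemma mask_is_linear : linear mask.
Proof.
move=> c x y; apply: ell2_val_inj => n.
change (mask_seq (c *: x + y) n = c * mask_seq x n + mask_seq y n).
by rewrite /mask_seq; case: ifP => // _; rewrite mulr0 addr0.
Qed.

HB.instance Definition _ := GRing.isLinear.Build R[i] ell2 ell2 *:%R mask mask_is_linear.

Lemma sqnorm2_mask_le x : sqnorm2 (mask x) <= sqnorm2 x.
Proof.
by apply: sqnorm2_le => n; apply: le_trans (series_mask_le x n) (series_le_sqnorm2 x n).
Qed.

Lemma mask_bounded : exists M : R, forall x, l2norm (mask x) <= M * l2norm x.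
Proof.
exists 1 => x; rewrite mul1r l2norm_le ?l2norm_ge0// sqr_l2norm.
exact: sqnorm2_mask_le.
Qed.

Definition coordinate_projector : bounded_op R := BoundedOp mask_bounded.

Lemma coordinate_projectorE x n : coordinate_projector x n = if P n then x n else 0.
Proof. by []. Qed.

Lemma projector_coordinate : projector coordinate_projector.
Proof.
split=> [x y|x].
  apply: (congr1 (fun u : nat -> R[i]^o => limn (series u))); apply/funext => n.
  rewrite !coordinate_projectorE; case: ifP => _ //.
  by rewrite rmorph0 mulr0 mul0r.
apply: ell2_val_inj => n; rewrite /= /mask_seq /= /mask_seq.
by case: (P n).
Qed.

Lemma diagonal_coordinate : diagonal_op coordinate_projector.
Proof.
move=> j k jk; rewrite inner_ebasis coordinate_projectorE /= (negbTE jk).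
by case: ifP.
Qed.
End CoordinateProjector.

(** The difference of the two sides is [|t * z - w|^2 / t]. A small [t] keeps the factor of [z] near
    [1]; the large factor falls on [w], which will be a truncation error. *)
Lemma sqnorm_add_le (R : realType) (t : R) (z w : R[i]) : 0 < t ->
  sqnorm (z + w) <= (1 + t) * sqnorm z + (1 + t^-1) * sqnorm w.
Proof.
move=> t_gt0; rewrite -subr_ge0.
have -> : (1 + t) * sqnorm z + (1 + t^-1) * sqnorm w - sqnorm (z + w) =
    t^-1 * sqnorm (t%:C * z - w).
  case: z w => a b [a' b']; rewrite /sqnorm /=; field; exact: lt0r_neq0.
by rewrite mulr_ge0 ?invr_ge0 ?sqnorm_ge0// ltW.
Qed.

(** * Paving of a single operator with zero diagonal *)

Section PavingOperators.
Variables (R : realType) (r : nat) (a : R) (T : bounded_op R).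
Hypotheses (r_gt1 : (1 < r)%N) (a_gt1 : 1 < a) (a2 : a ^+ 2 = 2 * r%:R + 5).
Hypothesis T0 : forall k, op_diag T k = 0.
Local Notation K := ('I_r * 'I_r * ('I_r * 'I_r))%type.
Local Notation bound := (2 * (6 * (a / (a ^+ 2 - 1))) * opnorm T).
Local Notation t j k := (T (ebasis R k) j).

(** Colourings and test vectors are indexed by [nat], so that one [chi] can be tested against all
    the sections. *)
Definition section_paved N (chi : nat -> K) := forall c (v : nat -> R[i]),
  (forall k, (k < N)%N -> chi k != c -> v k = 0) ->
  \sum_(0 <= j < N | chi j == c) sqnorm (\sum_(0 <= k < N) v k * t j k) <=
    bound ^+ 2 * \sum_(0 <= k < N) sqnorm (v k).

Lemma exists_section_paved N : exists chi, section_paved N chi.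
Proof.
(* Vectors being rows, [M] is the transpose of the section: [v *m M] holds the first [N] coordinates
   of the image of [v] under [T]. *)
pose M : 'M[R[i]]_N := \matrix_(k, j) t j k.
have vM (v : 'rV[R[i]]_N) j : (v *m M) 0 j = \sum_k v 0 k * t j k.
  by rewrite mxE; apply: eq_bigr => k _; rewrite mxE.
have M0 i : M i i = 0 by rewrite mxE -[RHS](T0 i) /op_diag inner_ebasis.
have Mb : bounded_by (opnorm T) M.
  move=> v; pose x := fun k => if insub k is Some i then v 0 i else 0.
  have xE (i : 'I_N) : x i = v 0 i by rewrite /x valK.
  have := sqnorm2_op_le T (truncation N x).
  have -> : sqnorm2 (truncation N x) = rdot v v.
    by rewrite sqnorm2_truncation big_mkord rdot_sqnorm; apply: eq_bigr => i _; rewrite xE.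
  apply: le_trans; apply: le_trans (series_le_sqnorm2 _ N).
  rewrite /series /= big_mkord rdot_sqnorm.
  apply: ler_sum => j _; rewrite sqmodE op_truncation big_mkord vM.
  by rewrite (eq_bigr (fun i : 'I_N => x i * t j i))// => i _; rewrite xE.
have [chi chiP] := matrix_paving r_gt1 a_gt1 a2 (opnorm_ge0 T) M0 Mb.
have c0 : 'I_r := Ordinal (ltnW r_gt1).
exists (fun k => if insub k is Some i then chi i else ((c0, c0), (c0, c0))) => c v vc.
have := chiP c (\row_k v k) _; rewrite rdot_sqnorm => /(_ _)/wrap[i ic|].
  by rewrite mxE vc// valK.
have -> : \sum_k sqnorm ((\row_k v k : 'rV[R[i]]_N) 0 k) = \sum_(0 <= k < N) sqnorm (v k).
  by rewrite big_mkord; apply: eq_bigr => k _; rewrite mxE.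
set S1 := (X in X <= _ -> _); set S2 := (X in _ -> X <= _).
suff -> : S1 = S2 by [].
rewrite /S1 /S2 [RHS]big_mkord; apply: eq_big => [j|j _]; first by rewrite valK.
by rewrite vM big_mkord; congr sqnorm; apply: eq_bigr => k _; rewrite mxE.
Qed.

(** Extending a vector by zero and dropping rows transfers the inequality from a section of size
    [M >= N] to that of size [N], where the limit colouring agrees with [f M]. *)
Lemma exists_paving_coloring : exists chi, forall N, section_paved N chi.
Proof.
pose f N := projT1 (cid (exists_section_paved N)).
have fP N : section_paved N (f N) := projT2 (cid (exists_section_paved N)).
have c0 : 'I_r := Ordinal (ltnW r_gt1).
have [chi chiP] := exists_cluster_coloring f ((c0, c0), (c0, c0)).
exists chi => N c v vc; have [M [NM agree]] := chiP N.
pose w k := if (k < N)%N then v k else 0.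
have w0 k : (N <= k)%N -> w k = 0 by move=> Nk; rewrite /w ltnNge Nk.
have wE k : (k < N)%N -> w k = v k by move=> kN; rewrite /w kN.
have := fP M c w _ => /(_ _)/wrap[k _ kc|].
  by rewrite /w; case: ifP => // kN; apply: vc => //; rewrite agree.
have sumw (F : nat -> R[i]) : \sum_(0 <= k < M) w k * F k = \sum_(0 <= k < N) v k * F k.
  rewrite (big_cat_nat _ NM)//= [X in _ + X]big_nat_cond [X in _ + X]big1 ?addr0.
    by rewrite big_nat_cond [RHS]big_nat_cond; apply: eq_bigr => k /andP[/andP[_ kN] _]; rewrite wE.
  by move=> k /andP[/andP[Nk _] _]; rewrite w0// mul0r.
have -> : \sum_(0 <= k < M) sqnorm (w k) = \sum_(0 <= k < N) sqnorm (v k).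
  rewrite (big_cat_nat _ NM)//= [X in _ + X]big_nat_cond [X in _ + X]big1 ?addr0.
    by rewrite big_nat_cond [RHS]big_nat_cond; apply: eq_bigr => k /andP[/andP[_ kN] _]; rewrite wE.
  by move=> k /andP[/andP[Nk _] _]; rewrite w0// /sqnorm /= expr0n addr0.
apply: le_trans; rewrite [leRHS](big_cat_nat _ NM)//=.
rewrite -[leLHS]addr0 lerD ?sumr_ge0// => [|k _]; last exact: sqnorm_ge0.
rewrite big_nat_cond [leRHS]big_nat_cond.
rewrite (eq_bigl (fun k => (0 <= k < N)%N && (f M k == c))); last first.
  by move=> k; case kN: (k < N)%N => //=; rewrite agree.
by apply: ler_sum => k _; rewrite sumw.
Qed.

(** Sections control [T] at truncations only. For a given partial sum, [N >= m] is taken so large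
    that the tail of [z] has square norm at most [d], and boundedness of [T] handles this tail; [d]
    tends to [0] for fixed [e], then [e] does. *)
Lemma sqnorm2_compression_le chi c x
    (Q := coordinate_projector R (fun k => chi k == c)) :
  (forall N, section_paved N chi) ->
  sqnorm2 (Q (T (Q x))) <= bound ^+ 2 * sqnorm2 x.
Proof.
move=> chiP; set B := bound ^+ 2; have B0 : 0 <= B by exact: sqr_ge0.
have E0 : 0 <= B * sqnorm2 x by rewrite mulr_ge0 ?sqnorm2_ge0.
apply: sqnorm2_le => m; have [z zE] : {z : ell2 R | z = Q x} by exists (Q x).
rewrite -zE.
have z0 k : chi k != c -> z k = 0 by move=> /negbTE kc; rewrite zE coordinate_projectorE kc.
have sE : series (sqmod (Q (T z))) m = \sum_(0 <= j < m | chi j == c) sqnorm (T z j).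
  rewrite /series /= [RHS]big_mkcond; apply: eq_bigr => j _; rewrite sqmodE /= /mask_seq.
  by case: ifP => // _; rewrite /sqnorm /= expr0n addr0.
rewrite sE; set S := \sum_(_ <= _ < _ | _) _.
have main e d : 0 < e -> 0 < d ->
    S <= (1 + e) * (B * sqnorm2 x) + (1 + e^-1) * (opnorm T ^+ 2 * d).
  move=> e0 d0.
  have [N [mN tailN]] : exists N, (m <= N)%N /\ sqnorm2 (z - truncation N z) <= d.
    have := @ell2_cvg R z => /cvgrPdist_le /(_ d d0) [N _ NP].
    exists (maxn m N); split; first exact: leq_maxl.
    set L := maxn m N; have := NP L (leq_maxr _ _); rewrite /= => dist.
    have tail : sqnorm2 z - series (sqmod z) L <= d by exact: le_trans (ler_norm _) dist.
    have [y yE] : {y | y = z - truncation L z} by exists (z - truncation L z).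
    have sq k : sqmod y k = if (k < L)%N then 0 else sqmod z k.
      rewrite !sqmodE yE ell2D ell2N truncationE; case: ifP => _; last by rewrite subr0.
      by rewrite subrr /sqnorm /= expr0n addr0.
    rewrite -yE; apply: sqnorm2_le => n; apply: le_trans tail.
    have z_le := @series_le_sqnorm2 R z.
    have [nL|Ln] := leqP n L.
      rewrite [leLHS](_ : _ = 0) ?subr_ge0//.
      rewrite /series /= big_nat_cond big1// => k /andP[/andP[_ kn] _].
      by rewrite sq (leq_trans kn).
    rewrite lerBrDl; apply: le_trans (z_le n).
    rewrite /series /= [leRHS](big_cat_nat _ (ltnW Ln))//= lerD2l.
    rewrite (big_cat_nat _ (ltnW Ln))//= [X in X + _]big_nat_cond big1 ?add0r.
      by apply: ler_sum => k _; rewrite sq; case: ifP => // _; rewrite sqmodE sqnorm_ge0.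
    by move=> k /andP[/andP[_ kL] _]; rewrite sq kL.
  pose zN := truncation N z.
  have TzE j : T z j = T zN j + T (z - zN) j.
    by rewrite -ell2D -linearD addrC subrK.
  apply: (@le_trans _ _ (\sum_(0 <= j < m | chi j == c)
      ((1 + e) * sqnorm (T zN j) + (1 + e^-1) * sqnorm (T (z - zN) j)))).
    by apply: ler_sum => j _; rewrite TzE sqnorm_add_le.
  rewrite big_split /= -!mulr_sumr lerD//.
    rewrite ler_wpM2l ?addr_ge0 ?(ltW e0)//.
    apply: (@le_trans _ _ (\sum_(0 <= j < N | chi j == c) sqnorm (T zN j))).
      rewrite [leRHS](big_cat_nat _ mN)//= lerDl sumr_ge0// => j _; exact: sqnorm_ge0.
    have := chiP N c z (fun k _ => @z0 k).
    under eq_bigr do rewrite -op_truncation.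
    move=> /le_trans; apply; rewrite ler_wpM2l// -sqnorm2_truncation.
    apply: (@le_trans _ _ (sqnorm2 z)); last by rewrite zE; exact: sqnorm2_mask_le.
    rewrite sqnorm2_truncation; apply: le_trans (series_le_sqnorm2 z N).
    by rewrite /series /=; apply: ler_sum => k _; rewrite sqmodE.
  rewrite ler_wpM2l ?addr_ge0 ?invr_ge0 ?(ltW e0)//.
  apply: (@le_trans _ _ (sqnorm2 (T (z - zN)))).
    apply: le_trans (series_le_sqnorm2 _ m); rewrite /series /= big_mkcond.
    by apply: ler_sum => j _; rewrite sqmodE; case: ifP => // _; exact: sqnorm_ge0.
  by apply: le_trans (sqnorm2_op_le T _) _; rewrite ler_wpM2l ?sqr_ge0.
have step e : 0 < e -> S <= (1 + e) * (B * sqnorm2 x).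
  move=> e0; apply/ler_addgt0Pr => d d0.
  (* The [+ 1] keeps [k] positive even when [T] has zero norm. *)
  pose k := (1 + e^-1) * (opnorm T ^+ 2 + 1).
  have k0 : 0 < k by apply: mulr_gt0; [rewrite addr_gt0 ?invr_gt0|rewrite ltr_wpDl ?sqr_ge0].
  apply: le_trans (main e (d / k) e0 (divr_gt0 d0 k0)) _.
  rewrite lerD2l mulrA; apply: (@le_trans _ _ (k * (d / k))); last by rewrite mulrC divfK// gt_eqF.
  rewrite ler_wpM2r ?(ltW (divr_gt0 d0 k0))// ler_wpM2l ?lerDl//.
  by rewrite addr_ge0 ?invr_ge0 ?(ltW e0).
apply/ler_addgt0Pr => d d0.
have k0 : 0 < B * sqnorm2 x + 1 by rewrite ltr_wpDl.
apply: le_trans (step _ (divr_gt0 d0 k0)) _.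
rewrite mulrDl mul1r lerD2l; apply: (@le_trans _ _ (d / (B * sqnorm2 x + 1) * (B * sqnorm2 x + 1))).
  by rewrite ler_wpM2l ?(ltW (divr_gt0 d0 k0))// lerDl.
by rewrite divfK// gt_eqF.
Qed.

End PavingOperators.

(** As [r >= (24 / eps) ^ 2] one has [a >= 24 / eps]; with [a ^ 2 - 1 >= a ^ 2 / 2] this gives
    [12 * a / (a ^ 2 - 1) <= 24 / a <= eps]. *)
Lemma exists_paving_parameters (R : realType) (eps : R) : 0 < eps ->
  exists r a, [/\ (1 < r)%N, 1 < a, a ^+ 2 = 2 * r%:R + 5 &
    2 * (6 * (a / (a ^+ 2 - 1))) <= eps].
Proof.
move=> e0; pose b := (24 / eps) ^+ 2; pose r := (Num.bound b).+2.
have r_ge : b <= r%:R.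
  apply: le_trans (ltW (archi_boundP (sqr_ge0 _))) _.
  by rewrite ler_nat /r -/b -addn2 leq_addr.
pose a := Num.sqrt (2 * r%:R + 5 : R).
have r2 : 2 <= r%:R :> R by rewrite (ler_nat _ 2).
have a2 : a ^+ 2 = 2 * r%:R + 5 by rewrite sqr_sqrtr//; lra.
have a0 : 0 <= a by exact: sqrtr_ge0.
have a_gt3 : 3 <= a by rewrite -ler_sqr ?nnegrE// a2; lra.
have e24 : 24 / eps <= a.
  by rewrite -ler_sqr ?nnegrE ?divr_ge0 ?(ltW e0)// a2 -/b; lra.
exists r, a; split=> //; first by lra.
have a21 : 0 < a ^+ 2 - 1 by nra.
rewrite !mulrA ler_pdivrMr//.
move: e24; rewrite ler_pdivrMr// => e24.
have : a * 24 <= a * (a * eps) by rewrite ler_wpM2l.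
nra.
Qed.

Theorem mainTheorem1 (R : realType) :
  forall eps : R, 0 < eps ->
  exists r : nat,
  forall T : bounded_op R, (forall k : nat, op_diag T k = 0) ->
  exists Q : 'I_r -> bounded_op R,
    (forall i : 'I_r, projector (Q i) /\ diagonal_op (Q i)) /\
    (forall x : ell2 R, \sum_(i < r) Q i x = x) /\
    (forall i : 'I_r,
       opnorm (comp_op (Q i) (comp_op T (Q i))) <= eps * opnorm T).
Proof.
move=> eps eps_gt0.
have [s [a [s_gt1 a_gt1 a2 bound_le]]] := exists_paving_parameters eps_gt0.
(* Four one-sided pavings with [s] colours each are superposed, hence [s ^ 4] projectors. *)
pose K : finType := ('I_s * 'I_s * ('I_s * 'I_s))%type.
exists #|K| => T T0; have [chi chiP] := exists_paving_coloring s_gt1 a_gt1 a2 T0.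
pose Q (i : 'I_#|K|) := coordinate_projector R (fun k => chi k == enum_val i).
exists Q; split; first by move=> i; split; [exact: projector_coordinate|exact: diagonal_coordinate].
split=> [x|i].
  apply: ell2_val_inj => n; rewrite ell2_sum (bigD1 (enum_rank (chi n)))//= big1 ?addr0.
    by rewrite /mask_seq enum_rankK eqxx.
  move=> i ni; rewrite /mask_seq; case: eqP => // chin.
  by move: ni; rewrite chin enum_valK eqxx.
have [ne _] := opnorm_has_sup (comp_op (Q i) (comp_op T (Q i))).
apply: ge_sup ne _ => _ [x /= x1 <-].
have e0 : 0 <= eps * opnorm T by rewrite mulr_ge0 ?opnorm_ge0// ltW.
rewrite l2norm_le//; apply: le_trans (sqnorm2_compression_le (enum_val i) x chiP) _.
have x2 : sqnorm2 x <= 1 by rewrite -sqr_l2norm expr_le1// l2norm_ge0.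
apply: (@le_trans _ _ ((2 * (6 * (a / (a ^+ 2 - 1))) * opnorm T) ^+ 2)).
  by rewrite ler_piMr ?sqr_ge0.
rewrite ler_sqr ?nnegrE//; last first.
  rewrite mulr_ge0 ?opnorm_ge0// !mulr_ge0// ?invr_ge0 ?(ltW (lt_trans ltr01 a_gt1))//.
  by rewrite subr_ge0 exprn_ege1// ltW.
by rewrite ler_wpM2r ?opnorm_ge0.
Qed.
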